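(* Let $\mathcal{V}$ be an abelian Mal'cev variety. Then $\mathcal{V}$ is finitely based if and only if all of the following hold: (1) $\mathcal{V}$ has finite type; (2) the ring $\mathbf{R}_\mathcal{V}$ of binary idempotent terms of $\mathcal{V}$ is finitely presented; (3) the $\mathbf{R}_\mathcal{V}$-module $\mathbf{M}_\mathcal{V}$ of unary terms of $\mathcal{V}$ is finitely presented.
   Context: A type $\sigma$ is a set of function symbols with arities; an algebra of type $\sigma$ interprets each symbol as an operation. A variety is a class of algebras of a fixed type defined by a set $\Sigma$ of equations (a basis); it is finitely based if it has a finite basis, and it has finite type if $\sigma$ is finite. A variety $\mathcal{V}$ is Mal'cev if there is a term $m(x,y,z)$ with $\mathcal{V}\models m(x,x,y)\approx y\approx m(y,x,x)$. An algebra $\mathbf{A}$ is abelian if $[1_\mathbf{A},1_\mathbf{A}]=0_\mathbf{A}$ in the sense of the term-condition commutator (for Mal'cev algebras this is equivalent to $m$ commuting with every basic operation); $\mathcal{V}$ is abelian if all its members are. For a Mal'cev variety, let $F_\mathcal{V}(x,z)$ be the universe of the free algebra in $\mathcal{V}$ on $x,z$, $F_\mathcal{V}(z)$ that of the free algebra on $z$, and $F_\mathcal{V}^{id}(x,z)=\{t\in F_\mathcal{V}(x,z): t(z,z)=z\}$. For $s,t\in F_\mathcal{V}(x,z)$ define $s+t:=m(s(x,z),z,t(x,z))$, $-s:=m(z,s(x,z),z)$, $s\cdot t:=s(t(x,z),z)$. Then $\mathbf{R}_\mathcal{V}:=\langle F_\mathcal{V}^{id}(x,z),+,-,\cdot\rangle$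 is a ring with identity $x$ and zero $z$, and $\mathbf{M}_\mathcal{V}:=\langle F_\mathcal{V}(z),+,-\rangle$ with action $r\cdot v:=r(v,z)$ ($r\in F_\mathcal{V}^{id}(x,z)$, $v\in F_\mathcal{V}(z)$) is an $\mathbf{R}_\mathcal{V}$-module with zero $z$.
   Formalization: Added assumption: either the type is finite, or the variety is nontrivial and the type has only finitely many nullary symbols. Without it the claim fails, e.g. for the trivial variety of infinite type, or abelian groups with infinitely many free constants. *)

(* Defs.v *)
From HB Require Import structures.
From mathcomp Require Import all_boot all_algebra.
From mathcomp Require Import boolp classical_sets cardinality.
From mathcomp.multinomials Require Import monalg.

Set Implicit Arguments.
Unset Strict Implicit.
Unset Printing Implicit Defensive.

Import GRing.Theory.
Local Open Scope quotient_scope.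
Local Open Scope classical_set_scope.
Local Open Scope ring_scope.

Record signature := Signature { symb :> Type; arity : symb -> nat }.

Definition finite_type (sg : signature) : Prop := finite_set [set: sg].

Inductive term (sg : signature) (X : Type) : Type :=
| Var of X
| App (f : sg) of ('I_(arity f) -> term sg X).
Arguments Var {sg X}.

Record algebra (sg : signature) := Algebra {
  carrier :> Type;
  op : forall f : sg, ('I_(arity f) -> carrier) -> carrier;
  carrier_nonempty : inhabited carrier }.

Fixpoint eval (sg : signature) (A : algebra sg) (X : Type) (v : X -> A)
    (t : term sg X) : A :=
  match t with
  | Var x => v x
  | App f args => op (fun i => eval v (args i))
  end.

Fixpoint subst (sg : signature) (X Y : Type) (v : X -> term sg Y)
    (t : term sg X) : term sg Y :=
  match t with
  | Var x => v x
  | App f args => App (fun i => subst v (args i))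
  end.

Definition equation (sg : signature) : Type := (term sg nat * term sg nat)%type.

Definition satisfies (sg : signature) (A : algebra sg) (X : Type)
    (s t : term sg X) : Prop :=
  forall v : X -> A, eval v s = eval v t.

(* Classes of algebras are predicates [algebra sg -> Prop] rather than [set]s:
   the universe of [set] lies above those of the carriers, which would forbid
   the quotient [free] below from being a carrier. *)
Definition is_basis (sg : signature) (V : algebra sg -> Prop)
    (E : set (equation sg)) : Prop :=
  forall A, V A <-> (forall e, E e -> satisfies A e.1 e.2).

Definition is_variety (sg : signature) (V : algebra sg -> Prop) : Prop :=
  exists E, is_basis V E.

Definition finitely_based (sg : signature) (V : algebra sg -> Prop) : Prop :=
  exists E, finite_set E /\ is_basis V E.

Definition nontrivial (sg : signature) (V : algebra sg -> Prop) : Prop :=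
  exists A, V A /\ exists a b : A, a <> b.

Definition triple (T : Type) (a b c : T) (i : 'I_3) : T :=
  nth a [:: a; b; c] i.

Definition maltsev_term (sg : signature) (V : algebra sg -> Prop)
    (m : term sg 'I_3) : Prop :=
  forall A, V A -> forall x y : A,
    eval (triple x x y) m = y /\ eval (triple y x x) m = y.

Section Commutator.
Variables (sg : signature) (A : algebra sg).
Implicit Types alpha beta delta : A -> A -> Prop.

Definition congruence delta : Prop :=
  [/\ forall a, delta a a,
      forall a b, delta a b -> delta b a,
      forall a b c, delta a b -> delta b c -> delta a c
    & forall (f : sg) (a b : 'I_(arity f) -> A),
        (forall i, delta (a i) (b i)) -> delta (op a) (op b)].

Definition centralizes alpha beta delta : Prop :=
  forall (p q : nat) (t : term sg ('I_p + 'I_q)%type)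
         (a b : 'I_p -> A) (c d : 'I_q -> A),
    (forall i, alpha (a i) (b i)) -> (forall j, beta (c j) (d j)) ->
    let ev u w := eval (fun k => match k with inl i => u i | inr j => w j end) t
    in delta (ev a c) (ev a d) -> delta (ev b c) (ev b d).

(* [alpha, beta] is the least congruence delta such that alpha centralizes
   beta modulo delta. *)
Definition commutator alpha beta : A -> A -> Prop :=
  fun a b => forall delta, congruence delta -> centralizes alpha beta delta ->
    delta a b.

Definition abelian_algebra : Prop :=
  forall a b, commutator (fun _ _ => True) (fun _ _ => True) a b <-> a = b.

End Commutator.

Definition abelian (sg : signature) (V : algebra sg -> Prop) : Prop :=
  forall A, V A -> abelian_algebra A.

HB.instance Definition _ sg X := gen_eqMixin (term sg X).
HB.instance Definition _ sg X := gen_choiceMixin (term sg X).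

Section FreeAlgebra.
Variables (sg : signature) (V : algebra sg -> Prop) (X : Type).

Definition eqterm : rel (term sg X) :=
  fun s t => `[< forall A, V A -> satisfies A s t >].

Lemma eqterm_refl : reflexive eqterm.
Proof. by move=> t; apply/asboolP. Qed.

Lemma eqterm_sym : symmetric eqterm.
Proof.
by move=> s t; apply: asbool_equiv_eq; split=> h A VA v; rewrite (h A VA).
Qed.

Lemma eqterm_trans : transitive eqterm.
Proof.
move=> s t u /asboolP h1 /asboolP h2; apply/asboolP => A VA v.
by rewrite (h1 A VA) (h2 A VA).
Qed.

Canonical eqterm_equiv := EquivRel eqterm eqterm_refl eqterm_sym eqterm_trans.

Definition free : Type := {eq_quot eqterm}.
HB.instance Definition _ := EqQuotient.on free.
HB.instance Definition _ := Choice.on free.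

Definition free_op (f : sg) (args : 'I_(arity f) -> free) : free :=
  \pi_free (App (fun i => repr (args i))).

(* The argument x0 only witnesses that the algebra is nonempty. *)
Definition free_algebra (x0 : X) : algebra sg :=
  Algebra free_op (inhabits (\pi_free (Var x0))).

End FreeAlgebra.

Inductive xz := vx | vz.

Section Evaluation.
Variables (sg : signature) (V : algebra sg -> Prop).

Definition F2 : algebra sg := free_algebra V vz.
Definition F1 : algebra sg := free_algebra V tt.

Definition x2 : free V xz := \pi_(free V xz) (Var vx).
Definition z2 : free V xz := \pi_(free V xz) (Var vz).
Definition z1 : free V unit := \pi_(free V unit) (Var tt).

(* [at2 t a b] is t(a, b) computed in A; on members of V it depends only on
   the class of t. *)
Definition at2 (A : algebra sg) (t : free V xz) (a b : A) : A :=
  eval (fun i => if i is vx then a else b) (repr t).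

Definition m3 (A : algebra sg) (m : term sg 'I_3) (a b c : A) : A :=
  eval (triple a b c) m.

End Evaluation.

Section Facts.
Variables (sg : signature) (V : algebra sg -> Prop).

Lemma eval_subst (A : algebra sg) X Y (w : Y -> A) (v : X -> term sg Y) t :
  eval w (subst v t) = eval (fun i => eval w (v i)) t.
Proof. by elim: t => //= f args IH; congr op; apply: funext => i. Qed.

Lemma piP X (s t : term sg X) :
  \pi_(free V X) s = \pi_(free V X) t <->
  forall A, V A -> satisfies A s t.
Proof. by split=> [/eqmodP/asboolP|h]; [|apply/eqmodP/asboolP]. Qed.

Lemma repr_pi X (t : term sg X) (A : algebra sg) (v : X -> A) : V A ->
  eval v (repr (\pi_(free V X) t)) = eval v t.
Proof.
by move=> VA; have /piP := reprK (\pi_(free V X) t); apply.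
Qed.

Lemma eval_free X Y (y0 : Y) (v : X -> term sg Y) (t : term sg X) :
  eval (A := free_algebra V y0) (fun i => \pi_(free V Y) (v i)) t
  = \pi_(free V Y) (subst v t).
Proof.
elim: t => //= f args IH; rewrite /free_op; apply/piP => A VA w /=.
by congr op; apply: funext => i; rewrite IH repr_pi.
Qed.

Lemma eval_free_repr X Y (y0 : Y) (v : X -> free V Y) (t : term sg X) :
  eval (A := free_algebra V y0) v t
  = \pi_(free V Y) (subst (fun i => repr (v i)) t).
Proof.
by rewrite -(eval_free y0); congr eval; apply: funext => i; rewrite reprK.
Qed.

Lemma free_satisfies X Y (y0 : Y) (s t : term sg X) :
  (forall A, V A -> satisfies A s t) -> satisfies (free_algebra V y0) s t.
Proof.
move=> h v; rewrite !eval_free_repr; apply/piP => A VA w.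
by rewrite !eval_subst; apply: h.
Qed.

Lemma repr_pi_free X Y (y0 : Y) (t : term sg X) (v : X -> free V Y) :
  eval (A := free_algebra V y0) v (repr (\pi_(free V X) t))
  = eval (A := free_algebra V y0) v t.
Proof. by apply: free_satisfies => A VA w; exact: repr_pi. Qed.

Lemma eval_repr_eval X Y Z (y0 : Y) (z0 : Z) (t : term sg X)
    (u : X -> free V Y) (v : Y -> free V Z) :
  eval (A := free_algebra V z0) v (repr (eval (A := free_algebra V y0) u t))
  = eval (A := free_algebra V z0)
      (fun i => eval (A := free_algebra V z0) v (repr (u i))) t.
Proof. by rewrite (eval_free_repr y0) repr_pi_free eval_subst. Qed.

Variable m : term sg 'I_3.
Hypothesis hm : maltsev_term V m.
Hypothesis hab : abelian V.

Lemma triple_map (T U : Type) (h : T -> U) a b c :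
  (fun i => h (triple a b c i)) = triple (h a) (h b) (h c).
Proof. by apply: funext => -[[|[|[]]]]. Qed.

Lemma term_condition (A : algebra sg) p q (t : term sg ('I_p + 'I_q)%type)
    (a b : 'I_p -> A) (c d : 'I_q -> A) : V A ->
  let ev u w := eval (fun k => match k with inl i => u i | inr j => w j end) t
  in ev a c = ev a d -> ev b c = ev b d.
Proof.
move=> VA ev e; apply/(hab VA) => delta cong cen.
apply: (cen p q t a b) => //.
by rewrite -!/(ev _ _) e; case: cong.
Qed.

Lemma maltsev_commutes (A : algebra sg) k (t : term sg 'I_k)
    (x y z : 'I_k -> A) : V A ->
  eval (fun i => m3 m (x i) (y i) (z i)) t
  = m3 m (eval x t) (eval y t) (eval z t).
Proof.
move=> VA; set G := LHS; set H := RHS.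
(* The term condition is applied with x in the first block and y, z and an
   auxiliary constant e in the second. *)
pose Y : 'I_k -> 'I_(k + k + 1) := fun i => lshift 1 (lshift k i).
pose Z : 'I_k -> 'I_(k + k + 1) := fun i => lshift 1 (rshift k i).
pose E : 'I_(k + k + 1) := rshift (k + k) ord0.
pose bl (y z : 'I_k -> A) (e : A) (j : 'I_(k + k + 1)) :=
  match fintype.split j with
  | inl j' => match fintype.split j' with inl i => y i | inr i => z i end
  | inr _ => e end.
have blY y' z' e i : bl y' z' e (Y i) = y' i.
  by rewrite /bl /Y (unsplitK (inl _)) (unsplitK (inl _)).
have blZ y' z' e i : bl y' z' e (Z i) = z' i.
  by rewrite /bl /Z (unsplitK (inl _)) (unsplitK (inr _)).
have blE y' z' e : bl y' z' e E = e by rewrite /bl /E (unsplitK (inr _)).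
pose T3 (a b c : term sg ('I_k + 'I_(k + k + 1))%type) :=
  subst (triple a b c) m.
pose xx i : term sg ('I_k + 'I_(k + k + 1))%type := Var (inl i).
pose rr (j : 'I_(k + k + 1)) : term sg ('I_k + 'I_(k + k + 1))%type :=
  Var (inr j).
pose Q := T3 (subst (fun i => T3 (xx i) (rr (Y i)) (rr (Z i))) t)
   (T3 (subst xx t) (subst (fun i => rr (Y i)) t)
       (subst (fun i => rr (Z i)) t)) (rr E).
have evQ (x' y' z' : 'I_k -> A) e :
    eval (fun k => match k with inl i => x' i | inr j => bl y' z' e j end) Q
    = m3 m (eval (fun i => m3 m (x' i) (y' i) (z' i)) t)
        (m3 m (eval x' t) (eval y' t) (eval z' t)) e.
  rewrite /Q /T3 eval_subst triple_map /= blE -/(m3 _ _ _ _).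
  congr m3.
    rewrite eval_subst; congr eval; apply: funext => i.
    by rewrite eval_subst triple_map /= blY blZ.
  rewrite eval_subst triple_map !eval_subst /=.
  congr m3; congr eval; apply: funext => i /=; first by rewrite blY.
  by rewrite blZ.
have mr (a b : A) : m3 m a b b = a by have [] := hm VA b a.
have ml (a b : A) : m3 m a a b = b by have [] := hm VA a b.
have Qyz (x' y' : 'I_k -> A) e :
    m3 m (eval (fun i => m3 m (x' i) (y' i) (y' i)) t)
        (m3 m (eval x' t) (eval y' t) (eval y' t)) e = e.
  by under eq_fun do rewrite mr; rewrite mr ml.
have Qxy (y' z' : 'I_k -> A) e :
    m3 m (eval (fun i => m3 m (y' i) (y' i) (z' i)) t)
        (m3 m (eval y' t) (eval y' t) (eval z' t)) e = e.
  by under eq_fun do rewrite ml; rewrite ml ml.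
have := @term_condition A _ _ Q y x (bl y y H) (bl y z H) VA.
rewrite /= !evQ Qyz Qxy Qyz => /(_ erefl) e.
by rewrite -/G -/H in e; rewrite -[LHS](mr _ H) -e.
Qed.

End Facts.

Section FreeFacts.
Variables (sg : signature) (V : algebra sg -> Prop) (m : term sg 'I_3).
Hypothesis hm : maltsev_term V m.
Hypothesis hab : abelian V.
Variables (X : Type) (x0 : X).
Local Notation F := (free_algebra V x0).
Local Notation p := (m3 (A := F) m).

Lemma free_ml (a b : F) : p a a b = b.
Proof.
have := @free_satisfies sg V bool X x0
  (subst (triple (Var true) (Var true) (Var false)) m) (Var false).
move=> /(_ _ (fun i : bool => if i then a else b)).
rewrite /= eval_subst triple_map /=; apply=> A VA v.
by rewrite eval_subst triple_map; have [] := hm VA (v true) (v false).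
Qed.

Lemma free_mr (a b : F) : p a b b = a.
Proof.
have := @free_satisfies sg V bool X x0
  (subst (triple (Var false) (Var true) (Var true)) m) (Var false).
move=> /(_ _ (fun i : bool => if i then b else a)).
rewrite /= eval_subst triple_map /=; apply=> A VA v.
by rewrite eval_subst triple_map; have [] := hm VA (v true) (v false).
Qed.

Lemma free_commutes k (t : term sg 'I_k) (a b c : 'I_k -> F) :
  eval (fun i => p (a i) (b i) (c i)) t = p (eval a t) (eval b t) (eval c t).
Proof.
pose w j (i : 'I_k) : term sg ('I_3 * 'I_k)%type := Var (j, i).
have := @free_satisfies sg V ('I_3 * 'I_k)%type X x0
  (subst (fun i => subst (fun j => w j i) m) t)
  (subst (fun j => subst (w j) t) m).
move=> /(_ _ (fun q => triple a b c q.1 q.2)).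
have E1 (A : algebra sg) (v : 'I_3 * 'I_k -> A) :
    eval v (subst (fun i => subst (fun j => w j i) m) t) =
    eval (fun i => m3 m (v (inord 0, i)) (v (inord 1, i)) (v (inord 2, i))) t.
  rewrite eval_subst; congr eval; apply: funext => i.
  rewrite eval_subst /m3; congr eval; apply: funext => j /=.
  case: j => [[|[|[|//]]] hj] /=; congr (v (_, i)); apply: val_inj;
  by rewrite /= inordK.
have E2 (A : algebra sg) (v : 'I_3 * 'I_k -> A) :
    eval v (subst (fun j => subst (w j) t) m) =
    m3 m (eval (fun i => v (inord 0, i)) t) (eval (fun i => v (inord 1, i)) t)
      (eval (fun i => v (inord 2, i)) t).
  rewrite eval_subst /m3; congr eval; apply: funext => j.
  rewrite eval_subst /=.
  case: j => [[|[|[|//]]] hj] /=; congr eval; apply: funext => i;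
  congr (v (_, i)); apply: val_inj; by rewrite /= inordK.
rewrite E1 E2 /triple /= !inordK //=; apply=> A VA v.
by rewrite E1 E2 (maltsev_commutes hm hab).
Qed.

Lemma free_entropic (a b c d e f g h i : F) :
  p (p a b c) (p d e f) (p g h i) = p (p a d g) (p b e h) (p c f i).
Proof.
have := free_commutes m (triple a d g) (triple b e h) (triple c f i).
rewrite -/(m3 _ _ _ _) => <-.
rewrite {1}/m3; congr eval; apply: funext => -[[|[|[|//]]] hj] //.
Qed.

Variable z : F.

Lemma free_addC (a b : F) : p a z b = p b z a.
Proof.
transitivity (p (p z z a) (p z z z) (p b z z)).
  by rewrite !free_ml free_mr.
by rewrite free_entropic !free_ml free_mr.
Qed.

Lemma free_addA (a b c : F) : p a z (p b z c) = p (p a z b) z c.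
Proof.
transitivity (p (p a z z) (p z z z) (p b z c)).
  by rewrite free_ml free_mr.
by rewrite free_entropic !free_ml.
Qed.

Lemma free_addN (a : F) : p (p z a z) z a = z.
Proof.
transitivity (p (p z a z) (p z z z) (p z z a)).
  by rewrite !free_ml.
by rewrite free_entropic !free_ml !free_mr.
Qed.

Lemma at2_m3 (t : free V xz) (a a' b b' c c' : F) :
  at2 t (p a b c) (p a' b' c') = p (at2 t a a') (at2 t b b') (at2 t c c').
Proof.
pose w (i : 'I_2) : xz := if val i is 0%N then vx else vz.
pose g (i : xz) : 'I_2 := if i is vx then ord0 else ord_max.
have gK i : w (g i) = i by case: i.
have E (u u' : F) :
    at2 t u u' = eval (fun i => if w i is vx then u else u')
                   (subst (fun i => Var (g i)) (repr t)).
  by rewrite /at2 eval_subst; congr eval; apply: funext => i; rewrite /= gK.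
rewrite !E; apply: (etrans _ (free_commutes _ _ _ _)).
by congr eval; apply: funext => i; case: (w i).
Qed.

End FreeFacts.

Section Ring.
Variables (sg : signature) (V : algebra sg -> Prop) (m : term sg 'I_3).

Definition idempotent (t : free V xz) : bool :=
  at2 (A := F1 V) t (z1 V) (z1 V) == z1 V.

Definition bin_add (s t : free V xz) : free V xz :=
  m3 (A := F2 V) m s (z2 V) t.
Definition bin_opp (s : free V xz) : free V xz :=
  m3 (A := F2 V) m (z2 V) s (z2 V).
Definition bin_mul (s t : free V xz) : free V xz :=
  at2 (A := F2 V) s t (z2 V).

Definition un_add (s t : free V unit) : free V unit :=
  m3 (A := F1 V) m s (z1 V) t.
Definition un_opp (s : free V unit) : free V unit :=
  m3 (A := F1 V) m (z1 V) s (z1 V).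
Definition un_scale (r : free V xz) (v : free V unit) : free V unit :=
  at2 (A := F1 V) r v (z1 V).

Lemma at2_m3E X (x0 : X) (s t u : F2 V) (a b : free_algebra V x0) :
  at2 (A := free_algebra V x0) (m3 m s t u) a b
  = m3 (A := free_algebra V x0) m (at2 s a b) (at2 t a b) (at2 u a b).
Proof.
rewrite /at2 /m3 (eval_repr_eval vz x0).
by rewrite (triple_map (fun u => eval _ (repr u))).
Qed.

Lemma at2_at2 X (x0 : X) (s t u : F2 V) (a b : free_algebra V x0) :
  at2 (A := free_algebra V x0) (at2 s t u) a b
  = at2 (A := free_algebra V x0) s (at2 t a b) (at2 u a b).
Proof.
rewrite /at2 (eval_repr_eval vz x0).
by congr eval; apply: funext => -[].
Qed.

Lemma at2_x2 X (x0 : X) (a b : free_algebra V x0) : at2 (x2 V) a b = a.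
Proof. by rewrite /at2 (repr_pi_free x0). Qed.

Lemma at2_z2 X (x0 : X) (a b : free_algebra V x0) : at2 (z2 V) a b = b.
Proof. by rewrite /at2 (repr_pi_free x0). Qed.

Lemma at2_eta (t : F2 V) : at2 (A := F2 V) t (x2 V) (z2 V) = t.
Proof.
rewrite /at2 -[RHS]reprK.
rewrite (_ : (fun i => _) = fun i : xz => \pi_(free V xz) (Var i)); last first.
  by apply: funext => -[].
rewrite eval_free; apply/piP => A VA w.
by rewrite eval_subst.
Qed.

(* An idempotent t satisfies t(c, c) = c everywhere, not only at z. *)
Lemma idem_at2 X (x0 : X) (t : F2 V) (c : free_algebra V x0) :
  idempotent t -> at2 t c c = c.
Proof.
move=> /eqP h.
pose ext (u : F1 V) : free_algebra V x0 :=
  eval (A := free_algebra V x0) (fun=> c) (repr u).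
have extz : ext (z1 V) = c by rewrite /ext (repr_pi_free x0).
rewrite -[RHS]extz -h /ext /at2 (eval_repr_eval tt x0).
by congr eval; apply: funext => -[]; rewrite -[LHS]extz.
Qed.

Hypothesis hm : maltsev_term V m.
Hypothesis hab : abelian V.

Lemma idem_x2 : idempotent (x2 V).
Proof. by rewrite /idempotent at2_x2. Qed.

Lemma idem_z2 : idempotent (z2 V).
Proof. by rewrite /idempotent at2_z2. Qed.

Lemma idem_add s t : idempotent s -> idempotent t -> idempotent (bin_add s t).
Proof.
move=> /eqP hs /eqP ht; apply/eqP.
by rewrite at2_m3E at2_z2 hs ht (free_ml hm).
Qed.

Lemma idem_opp s : idempotent s -> idempotent (bin_opp s).
Proof.
move=> /eqP hs; apply/eqP.
by rewrite at2_m3E at2_z2 hs (free_ml hm).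
Qed.

Lemma idem_mul s t : idempotent s -> idempotent t -> idempotent (bin_mul s t).
Proof.
move=> /eqP hs /eqP ht; apply/eqP.
by rewrite at2_at2 ht at2_z2 hs.
Qed.

Lemma at2_addr X (x0 : X) (t : F2 V) (z a b : free_algebra V x0) :
  idempotent t ->
  at2 t (m3 (A := free_algebra V x0) m a z b) z
  = m3 (A := free_algebra V x0) m (at2 t a z) z (at2 t b z).
Proof.
move=> ht; transitivity (m3 m (at2 t a z) (at2 t z z) (at2 t b z)).
  by rewrite -(at2_m3 hm hab) (free_ml hm).
by rewrite idem_at2.
Qed.

(* The proofs hm and hab are parameters so that the ring structure below can
   be attached to the type. *)
Definition binary_ring of maltsev_term V m & abelian V : Type :=
  {t : free V xz | idempotent t}.
Definition unary_module of maltsev_term V m & abelian V : Type := free V unit.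

Local Notation RV := (binary_ring hm hab).
Local Notation MV := (unary_module hm hab).

HB.instance Definition _ := Choice.on RV.
HB.instance Definition _ := SubType.on RV.
HB.instance Definition _ := Choice.on MV.

Definition R_zero : RV := Sub (z2 V) idem_z2.
Definition R_one : RV := Sub (x2 V) idem_x2.
Definition R_add (s t : RV) : RV := Sub (bin_add (val s) (val t)) (idem_add (valP s) (valP t)).
Definition R_opp (s : RV) : RV := Sub (bin_opp (val s)) (idem_opp (valP s)).
Definition R_mul (s t : RV) : RV := Sub (bin_mul (val s) (val t)) (idem_mul (valP s) (valP t)).

Lemma R_addA : associative R_add.
Proof. by move=> a b c; apply: val_inj; exact: (free_addA hm hab). Qed.

Lemma R_addC : commutative R_add.
Proof. by move=> a b; apply: val_inj; exact: (free_addC hm hab). Qed.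

Lemma R_add0 : left_id R_zero R_add.
Proof. by move=> a; apply: val_inj; exact: (free_ml hm). Qed.

Lemma R_addN : left_inverse R_zero R_opp R_add.
Proof. by move=> a; apply: val_inj; exact: (free_addN hm hab). Qed.

HB.instance Definition _ :=
  GRing.isZmodule.Build RV R_addA R_addC R_add0 R_addN.

Lemma R_mulA : associative R_mul.
Proof.
move=> a b c; apply: val_inj => /=.
by rewrite /bin_mul at2_at2 at2_z2.
Qed.

Lemma R_mul1l : left_id R_one R_mul.
Proof. by move=> a; apply: val_inj; exact: at2_x2. Qed.

Lemma R_mul1r : right_id R_one R_mul.
Proof. by move=> a; apply: val_inj; exact: at2_eta. Qed.

Lemma R_mulDl : left_distributive R_mul R_add.
Proof.
move=> a b c; apply: val_inj => /=.
by rewrite /bin_mul /bin_add at2_m3E at2_z2.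
Qed.

Lemma R_mulDr : right_distributive R_mul R_add.
Proof.
by move=> a b c; apply: val_inj; apply: at2_addr; exact: valP.
Qed.

HB.instance Definition _ :=
  GRing.Zmodule_isPzRing.Build RV R_mulA R_mul1l R_mul1r R_mulDl R_mulDr.

Lemma M_addA : associative (un_add : MV -> MV -> MV).
Proof. by move=> a b c; exact: (free_addA hm hab). Qed.

Lemma M_addC : commutative (un_add : MV -> MV -> MV).
Proof. by move=> a b; exact: (free_addC hm hab). Qed.

Lemma M_add0 : left_id (z1 V : MV) un_add.
Proof. by move=> a; exact: (free_ml hm). Qed.

Lemma M_addN : left_inverse (z1 V : MV) un_opp un_add.
Proof. by move=> a; exact: (free_addN hm hab). Qed.

HB.instance Definition _ :=
  GRing.isZmodule.Build MV M_addA M_addC M_add0 M_addN.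

Definition M_scale (r : RV) (v : MV) : MV := un_scale (val r) v.

Lemma M_scaleA a b v : M_scale a (M_scale b v) = M_scale (a * b) v.
Proof. by rewrite /M_scale /un_scale /= /bin_mul at2_at2 at2_z2. Qed.

Lemma M_scale1 : left_id 1 M_scale.
Proof. by move=> v; exact: at2_x2. Qed.

Lemma M_scaleDr : right_distributive M_scale +%R.
Proof.
by move=> r u v; apply: at2_addr; exact: valP.
Qed.

Lemma M_scaleDl v : {morph M_scale^~ v : a b / a + b}.
Proof.
by move=> a b; rewrite /M_scale /un_scale /= at2_m3E at2_z2.
Qed.

HB.instance Definition _ :=
  GRing.Zmodule_isLmodule.Build RV MV M_scaleA M_scale1 M_scaleDr M_scaleDl.

End Ring.

(* Z<x_1, .., x_n>: the integral monoid ring of the free monoid on n letters *)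
Definition free_ring (n : nat) := {malg int[{fmonom 'I_n}]}.

Definition two_sided_ideal (R : pzRingType) (I : set R) : Prop :=
  [/\ I 0, forall a b, I a -> I b -> I (a + b)
    & forall a b c, I b -> I (a * b * c)].

Definition ideal_generated (R : pzRingType) (S : set R) : set R :=
  [set a | forall I, two_sided_ideal I -> S `<=` I -> I a].

Definition submodule (R : pzRingType) (M : lmodType R) (N : set M) : Prop :=
  [/\ N 0, forall u v, N u -> N v -> N (u + v)
    & forall (r : R) u, N u -> N (r *: u)].

Definition submodule_generated (R : pzRingType) (M : lmodType R) (S : set M) :
    set M :=
  [set u | forall N, submodule N -> S `<=` N -> N u].

Definition finitely_presented_ring (R : pzRingType) : Prop :=
  exists (n : nat) (phi : {rmorphism free_ring n -> R}) (S : set (free_ring n)),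
    [/\ finite_set S, forall r, exists a, phi a = r
      & forall a, phi a = 0 <-> ideal_generated S a].

Definition finitely_presented_module (R : pzRingType) (M : lmodType R) : Prop :=
  exists (n : nat) (phi : {linear 'rV[R]_n -> M}) (S : set 'rV[R]_n),
    [/\ finite_set S, forall u, exists a, phi a = u
      & forall a, phi a = 0 <-> submodule_generated S a].

(* Main.v *)
Require Import Defs.
From HB Require Import structures.
From mathcomp Require Import all_boot all_algebra.
From mathcomp Require Import boolp classical_sets cardinality.
From mathcomp Require Import finmap.
From mathcomp.multinomials Require Import monalg.

Set Implicit Arguments.
Unset Strict Implicit.
Unset Printing Implicit Defensive.

Import Defs GRing.Theory.
Local Open Scope quotient_scope.
Local Open Scope classical_set_scope.
Local Open Scope ring_scope.

(* Fix a point z in an algebra A of V. Then m(a,b,c) = a - b + c for an abelian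
   group with zero z, R_V acts on it by r.a = r(a,z), and every term is affine:
   t(v) = sum_x r_{t,x}.v(x) + t(z,..,z), with r_{t,x} in R_V and t(z,..,z) the
   image of an element of M_V. Hence R_V is generated as a ring by the r_{f,i},
   and M_V as a module by the f(z,..,z), f ranging over the basic operations.

   If V has a finite basis, take the free ring on the symbols (f,i) and the free
   module on the symbols f. The coefficients of a term can be computed formally
   there, and the differences of the coefficients of the two sides of each basis
   equation generate all relations: on the quotient by these, the affine
   operations with the formal coefficients define an algebra of V, on which an
   element of the kernel must act as 0.

   Conversely, let V1 be defined by the finitely many equations saying that m is
   a Mal'cev term commuting with the basic operations. R_V is a finitely
   presented quotient of the finitely generated ring R_{V1}, so the kernel is a
   finitely generated ideal; adding its generators r as equations r = z makes
   the rings equal. The same is then done for the modules. An abelian Mal'cev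
   variety containing V with the same ring and module is V, since both determine
   the coefficients of every term.

   For finite type: a symbol f of positive arity absent from the basis and from
   m can be redefined arbitrarily, so as not to commute with m. *)

(** * Free rings *)

Definition free_ring_gen n (i : 'I_n) : free_ring n := << fmu i >>.

Section FreeRingEval.
Variables (R : pzRingType) (n : nat) (h : 'I_n -> R).

Definition free_ring_eval (g : free_ring n) : R :=
  \sum_(k <- msupp g) (\prod_(i <- fmonom_val k) h i) *~ g@_k.

(** The sum may run over any finite superset of the support, so two elements can be summed over a
    common index set. *)
Lemma free_ring_evalEw (d : {fset {fmonom 'I_n}}) (g : free_ring n) :
  fsubset (msupp g) d ->
  free_ring_eval g = \sum_(k <- d) (\prod_(i <- fmonom_val k) h i) *~ g@_k.
Proof.
move=> le; rewrite [LHS](big_fset_incl _ le) => //= x xd /mcoeff_outdom ->.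
by rewrite mulr0z.
Qed.

Lemma free_ring_evalU k c :
  free_ring_eval << c *g k >> = (\prod_(i <- fmonom_val k) h i) *~ c.
Proof.
by rewrite (free_ring_evalEw (msuppU_le)) big_seq_fset1 mcoeffUU.
Qed.

Fact free_ring_eval_zmod : zmod_morphism free_ring_eval.
Proof.
move=> a b.
pose d := fsetU (msupp a) (msupp b).
rewrite (@free_ring_evalEw d (a - b)) ?msuppB_le //.
rewrite (@free_ring_evalEw d a) ?fsubsetUl // (@free_ring_evalEw d b) ?fsubsetUr //.
by rewrite -sumrB; apply: eq_bigr => k _; rewrite mcoeffB mulrzBr.
Qed.

HB.instance Definition _ :=
  GRing.isZmodMorphism.Build (free_ring n) R free_ring_eval free_ring_eval_zmod.

Fact free_ring_eval_monoid : monoid_morphism free_ring_eval.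
Proof.
split; first by rewrite free_ring_evalU fm1 big_nil.
move=> a b; rewrite malgME raddf_sum mulr_suml /=; apply: eq_bigr => i _.
rewrite raddf_sum mulr_sumr /=; apply: eq_bigr => j _.
rewrite free_ring_evalU fmM big_cat /=.
by rewrite mulrzAr mulrzAl -mulrzA.
Qed.

HB.instance Definition _ :=
  GRing.isMonoidMorphism.Build (free_ring n) R free_ring_eval
    free_ring_eval_monoid.

Lemma free_ring_eval_gen i : free_ring_eval (free_ring_gen i) = h i.
Proof. by rewrite free_ring_evalU fmuE big_seq1 mulr1z. Qed.

End FreeRingEval.

(** Subrings serve below as induction principles: a property that defines a subring containing the
    generators holds everywhere. *)
Definition subring (R : pzRingType) (P : set R) : Prop :=
  [/\ P 1, forall a b, P a -> P b -> P (a - b)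
    & forall a b, P a -> P b -> P (a * b)].

Section Subring.
Variables (R : pzRingType) (P : set R).
Hypothesis hP : subring P.
Lemma subring0 : P 0.
Proof. by case: hP => h1 hB _; rewrite -(subrr 1); apply: hB. Qed.
Lemma subringN a : P a -> P (- a).
Proof. by move=> ?; rewrite -sub0r; case: hP => _ hB _; apply: hB => //; apply: subring0. Qed.
Lemma subringD a b : P a -> P b -> P (a + b).
Proof.
move=> Pa Pb; rewrite -[b]opprK; case: hP => _ hB _.
by apply: hB => //; apply: subringN.
Qed.
Lemma subring_sum I (r : seq I) (F : I -> R) : (forall i, P (F i)) -> P (\sum_(i <- r) F i).
Proof. move=> h; apply: big_ind => //; [exact: subring0|exact: subringD]. Qed.
Lemma subringMz a (c : int) : P a -> P (a *~ c).
Proof.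
move=> Pa; have hn k : P (a *+ k).
  by elim: k => [|k IH]; [exact: subring0|rewrite mulrS; apply: subringD].
by case: c => k; [exact: hn|rewrite NegzE mulrNz; apply: subringN; apply: hn].
Qed.
End Subring.

Lemma free_ring_subring n (P : set (free_ring n)) :
  subring P -> (forall i, P (free_ring_gen i)) -> forall a, P a.
Proof.
move=> hP hg a; rewrite (monalgE a); apply: (subring_sum hP) => k.
have -> : << a@_k *g k >> = << k >> *~ a@_k :> free_ring n.
  by apply/malgP => k'; rewrite mcoeffU raddfMz /= mcoeffU1; case: eqP => _;
     rewrite ?mulr1n ?mulr0n ?mul0rz ?mulrzz ?mul1r.
apply: (subringMz hP).
(* Monomials are words. The empty word is 1, and a longer word is its first letter times the
   rest. *)
case: k => k; elim: k => [|i k IH].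
  have -> : << FMonom [::] >> = 1 :> free_ring n; last first.
    by case: hP => h1 _ _; exact: h1.
  by apply: (congr1 (fun k => << k >>)); rewrite -fmoneE.
have -> : << FMonom (i :: k) >> = free_ring_gen i * << FMonom k >>.
  by rewrite /free_ring_gen malgM_def fgmulUU mulr1; congr (<< _ >>);
     apply/val_inj; rewrite /= fmM fmU.
by case: hP => _ _; apply; [apply: hg|apply: IH].
Qed.

Lemma free_ring_ext n (R : pzRingType) (f g : {rmorphism free_ring n -> R}) :
  (forall i, f (free_ring_gen i) = g (free_ring_gen i)) -> f =1 g.
Proof.
move=> h; apply: free_ring_subring => //; split; first by rewrite !rmorph1.
  by move=> a b /=; rewrite !rmorphB /= => -> ->.
by move=> a b /=; rewrite !rmorphM /= => -> ->.
Qed.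

(** * Affine form of terms *)

(** Countability of [xz] lets equations in x and z be renamed into variables from [nat]. *)
Definition xz_code (i : xz) : bool := if i is vx then true else false.
Definition xz_decode (b : bool) : xz := if b then vx else vz.
Lemma xz_codeK : cancel xz_code xz_decode. Proof. by case. Qed.
HB.instance Definition _ := Countable.copy xz (can_type xz_codeK).

Fixpoint vars (sg : signature) (X : Type) (t : term sg X) : seq X :=
  match t with
  | Var x => [:: x]
  | App f args => flatten [seq vars (args i) | i <- enum 'I_(arity f)]
  end.

Lemma vars_sub (sg : signature) (X : eqType) (f : sg)
    (args : 'I_(arity f) -> term sg X) i :
  {subset vars (args i) <= vars (App args)}.
Proof.
move=> x xi; apply/flattenP; exists (vars (args i)) => //.
by apply: map_f; rewrite mem_enum.
Qed.

Lemma eval_vars (sg : signature) (A : algebra sg) (X : eqType) (v w : X -> A)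
    (t : term sg X) : {in vars t, v =1 w} -> eval v t = eval w t.
Proof.
elim: t => [x|f args IH] h /=; first by apply: h; rewrite inE.
by congr op; apply: funext => i; apply: IH => x /vars_sub/h.
Qed.

Definition at_var (X : eqType) (T : Type) (z : T) (x : X) (a : T) (y : X) : T :=
  if y == x then a else z.

Section AffineSum.
Variables (X : eqType) (B C : zmodType) (F : (X -> B) -> C).
Hypothesis F_affine : forall v w, F (fun x => v x + w x) = F v - F (fun=> 0) + F w.

(** The map [F] minus its value at 0 is additive, so it splits along coordinates. The list [r] keeps
    the sum finite when [X] is not. *)
Lemma affine_sum (v : X -> B) (r : seq X) : uniq r ->
  F (fun x => if x \in r then v x else 0) =
  \sum_(x <- r) (F (at_var 0 x (v x)) - F (fun=> 0)) + F (fun=> 0).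
Proof.
elim: r => [_|y r IH /= /andP[yr ur]]; first by rewrite big_nil add0r.
rewrite big_cons -addrA -IH // -F_affine; congr F; apply: funext => x.
rewrite inE /at_var; case: eqP => [->|_] /=; first by rewrite (negPf yr) addr0.
by rewrite add0r.
Qed.

End AffineSum.

Section Variety.
Variables (sg : signature) (V : algebra sg -> Prop).

Lemma free_in_variety (hV : is_variety V) X (x0 : X) : V (free_algebra V x0).
Proof.
case: hV => E hE; apply/hE => e Ee; apply: free_satisfies => A /hE; exact.
Qed.

Lemma at2_pi (A : algebra sg) (VA : V A) (t : term sg xz) (a b : A) :
  at2 (\pi_(free V xz) t) a b = eval (fun i => if i is vx then a else b) t.
Proof. by rewrite /at2 repr_pi. Qed.

Lemma at2_eval (A : algebra sg) (VA : V A) X (u : X -> F2 V) (t : term sg X)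
    (a b : A) :
  at2 (eval (A := F2 V) u t) a b = eval (fun i => at2 (u i) a b) t.
Proof. by rewrite eval_free_repr at2_pi // eval_subst. Qed.

Variable m : term sg 'I_3.
Hypothesis hm : maltsev_term V m.
Hypothesis hab : abelian V.

(** * Modules over the ring of binary idempotent terms, on members of the variety *)

Section Member.
Variables (A : algebra sg) (VA : V A).
Local Notation p := (m3 (A := A) m).

Lemma maltsev_l (a b : A) : p a a b = b. Proof. by have [] := hm VA a b. Qed.
Lemma maltsev_r (a b : A) : p a b b = a. Proof. by have [] := hm VA b a. Qed.

Lemma maltsev_op (f : sg) (a b c : 'I_(arity f) -> A) :
  op (fun i => p (a i) (b i) (c i)) = p (op a) (op b) (op c).
Proof. exact: (maltsev_commutes hm hab (App (fun i => Var i))). Qed.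

Lemma maltsev_eval X (t : term sg X) (a b c : X -> A) :
  eval (fun i => p (a i) (b i) (c i)) t = p (eval a t) (eval b t) (eval c t).
Proof.
elim: t => //= f args IH; rewrite -maltsev_op; congr op; apply: funext => i.
exact: IH.
Qed.

(** As [m] commutes with itself, a 3 by 3 array may be evaluated by rows or by columns. The group
    laws below follow by padding arrays with the base point. *)
Lemma maltsev_entropic (a b c d e f g h i : A) :
  p (p a b c) (p d e f) (p g h i) = p (p a d g) (p b e h) (p c f i).
Proof.
rewrite -(maltsev_eval m (triple a d g) (triple b e h) (triple c f i)).
by congr eval; apply: funext => -[[|[|[|//]]] ?].
Qed.

Lemma maltsev_addC (z a b : A) : p a z b = p b z a.
Proof.
transitivity (p (p z z a) (p z z z) (p b z z)).
  by rewrite !maltsev_l maltsev_r.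
by rewrite maltsev_entropic !maltsev_l maltsev_r.
Qed.

Lemma maltsev_addA (z a b c : A) : p a z (p b z c) = p (p a z b) z c.
Proof.
transitivity (p (p a z z) (p z z z) (p b z c)).
  by rewrite maltsev_l maltsev_r.
by rewrite maltsev_entropic !maltsev_l.
Qed.

Lemma maltsev_addN (z a : A) : p (p z a z) z a = z.
Proof.
transitivity (p (p z a z) (p z z z) (p z z a)); first by rewrite !maltsev_l.
by rewrite maltsev_entropic !maltsev_l !maltsev_r.
Qed.

Lemma maltsev_sub (z a b c : A) : p (p a z (p z b z)) z c = p a b c.
Proof.
have -> : p a z (p z b z) = p a b z.
  transitivity (p (p a z z) (p z z z) (p z b z)).
    by rewrite maltsev_l maltsev_r.
  by rewrite maltsev_entropic !maltsev_l maltsev_r.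
transitivity (p (p a b z) (p z z z) (p z z c)); first by rewrite !maltsev_l.
by rewrite maltsev_entropic !maltsev_r maltsev_l.
Qed.

(** Idempotence is assumed only in the free algebra on one generator; sending that generator to [z]
    transfers it to [A]. *)
Lemma at2_idem (r : binary_ring hm hab) (z : A) : at2 (val r) z z = z.
Proof.
have /eqP := valP r; rewrite /at2 eval_free_repr => /piP/(_ A VA (fun=> z)).
rewrite eval_subst /=.
have -> // : (fun i => eval (fun=> z) (repr (if i is vx then z1 V else z1 V))) =
    fun i : xz => if i is vx then z else z.
by apply: funext => -[]; rewrite /z1 repr_pi.
Qed.

(** A copy of [A] whose type records the base point and the proofs, so that the group and module
    structures depending on them can be attached. *)
Definition pointed of maltsev_term V m & abelian V & V A & A : Type := A.

End Member.

Section Pointed.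
Variables (A : algebra sg) (VA : V A) (z : A).
Local Notation p := (m3 (A := A) m).
Local Notation R := (binary_ring hm hab).
Local Notation B := (pointed hm hab VA z).

HB.instance Definition _ := gen_eqMixin B.
HB.instance Definition _ := gen_choiceMixin B.

Definition pointed_add (a b : B) : B := p a z b.
Definition pointed_opp (a : B) : B := p z a z.

Lemma pointed_addA : associative pointed_add.
Proof. by move=> a b c; exact: maltsev_addA. Qed.
Lemma pointed_addC : commutative pointed_add.
Proof. by move=> a b; exact: maltsev_addC. Qed.
Lemma pointed_add0 : left_id (z : B) pointed_add.
Proof. by move=> a; exact: maltsev_l. Qed.
Lemma pointed_addN : left_inverse (z : B) pointed_opp pointed_add.
Proof. by move=> a; exact: maltsev_addN. Qed.

HB.instance Definition _ :=
  GRing.isZmodule.Build B pointed_addA pointed_addC pointed_add0 pointed_addN.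

Definition pointed_scale (r : R) (a : B) : B := at2 (A := A) (val r) a z.

Lemma at2_binmul (s t : F2 V) (a b : A) :
  at2 (bin_mul s t) a b = at2 s (at2 t a b) b.
Proof.
rewrite /bin_mul {2}/at2 at2_eval // {2}/at2; congr eval.
by apply: funext => -[] //; rewrite at2_pi.
Qed.

Lemma pointed_scaleA r s a :
  pointed_scale r (pointed_scale s a) = pointed_scale (r * s) a.
Proof. by rewrite /pointed_scale at2_binmul. Qed.

Lemma pointed_scale1 : left_id 1 pointed_scale.
Proof. by move=> a; rewrite /pointed_scale at2_pi. Qed.

(** The binary term commutes with [m], and the middle value r(z,z) collapses to z. *)
Lemma pointed_scaleDr : right_distributive pointed_scale +%R.
Proof.
move=> r a b; transitivity (p (at2 (val r) (a : A) z) (at2 (val r) z z)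
  (at2 (val r) (b : A) z)); last by rewrite at2_idem.
rewrite /pointed_scale /at2 -maltsev_eval //; congr eval.
by apply: funext => -[] //=; rewrite maltsev_l.
Qed.

Lemma pointed_scaleDl a : {morph pointed_scale^~ a : r s / r + s}.
Proof.
move=> r s; rewrite /pointed_scale /= {1}/bin_add /m3 at2_eval //.
by rewrite (triple_map (fun i => at2 i (a : A) z)) at2_pi.
Qed.

HB.instance Definition _ :=
  GRing.Zmodule_isLmodule.Build R B pointed_scaleA pointed_scale1
    pointed_scaleDr pointed_scaleDl.

Lemma pointed_maltsev (a b c : B) : p a b c = (a - b + c : B).
Proof. by rewrite -(maltsev_sub VA z). Qed.

Lemma pointed_scaleE (r : R) (a : B) : r *: a = at2 (A := A) (val r) a z.
Proof. by []. Qed.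

End Pointed.


Hypothesis hV : is_variety V.
Local Notation R := (binary_ring hm hab).

(** * Coefficients and constant parts of terms *)

Section Coef.
Variable X : eqType.

(** A partial derivative: t(z,..,x,..,z) - t(z,..,z). Subtracting the constant part is what makes it
    idempotent. *)
Definition coef_fun (t : term sg X) (x : X) : F2 V :=
  m3 (A := F2 V) m (eval (A := F2 V) (at_var (z2 V) x (x2 V)) t)
    (eval (A := F2 V) (fun=> z2 V) t) (z2 V).

Lemma at2_coef_fun (A : algebra sg) (VA : V A) t x (a z : A) :
  at2 (coef_fun t x) a z =
  m3 (A := A) m (eval (at_var z x a) t) (eval (fun=> z) t) z.
Proof.
rewrite /coef_fun {1}/m3 at2_eval // (triple_map (fun u => at2 u a z)).
rewrite !at2_eval // at2_pi //; congr m3; congr eval; apply: funext => y.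
  by rewrite /at_var; case: eqP => _; rewrite at2_pi.
Qed.

Lemma coef_fun_idem t x : idempotent (coef_fun t x).
Proof.
apply/eqP; rewrite at2_coef_fun; last exact: free_in_variety.
rewrite (_ : at_var _ _ _ = fun=> z1 V) ?(free_ml hm) //.
by apply: funext => y; rewrite /at_var if_same.
Qed.

Definition coef t x : R := Sub (coef_fun t x) (coef_fun_idem t x).

Lemma coef_satisfies (s t : term sg X) x :
  (forall A, V A -> satisfies A s t) -> coef s x = coef t x.
Proof.
move=> h; apply: val_inj => /=.
by rewrite /coef_fun !(h _ (free_in_variety hV vz)).
Qed.

Lemma coef_scale (A : algebra sg) (VA : V A) (z : A) t x
    (a : pointed hm hab VA z) :
  coef t x *: a = (eval (A := A) (at_var z x (a : A)) t : pointed hm hab VA z)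
                  - (eval (A := A) (fun=> z) t : pointed hm hab VA z).
Proof.
by rewrite pointed_scaleE at2_coef_fun // (@pointed_maltsev _ VA z) addr0.
Qed.

(** Every term commutes with [m], hence is affine for the group with zero [z]. The list [r] may
    exceed the variables of [t], so that both sides of an equation can share it. *)
Lemma eval_affine (A : algebra sg) (VA : V A) (z : A) t (r : seq X)
    (v : X -> pointed hm hab VA z) : uniq r -> {subset vars t <= r} ->
  eval (A := A) v t =
  \sum_(x <- r) coef t x *: v x + eval (A := A) (fun=> z) t
  :> pointed hm hab VA z.
Proof.
move=> ur tr.
(* Resetting the variables outside [r] to zero does not change the value of [t]. *)
rewrite (@eval_vars _ A _ _ (fun x => if x \in r then v x else 0)); last first.
  by move=> x /tr ->.
under eq_bigr do rewrite coef_scale.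
apply: (@affine_sum X (pointed hm hab VA z) (pointed hm hab VA z)
  (fun v => eval (A := A) v t)) => // v1 v2.
by rewrite -(@pointed_maltsev _ VA z) -(maltsev_eval VA).
Qed.

End Coef.

Definition op_coef (f : sg) (i : 'I_(arity f)) : R :=
  coef (App (fun j => Var j)) i.

Lemma op_affine (A : algebra sg) (VA : V A) (z : A) (f : sg)
    (v : 'I_(arity f) -> pointed hm hab VA z) :
  op (a := A) v =
  \sum_i op_coef i *: v i + op (a := A) (fun _ : 'I_(arity f) => z)
  :> pointed hm hab VA z.
Proof.
have := @eval_affine _ A VA z (App (fun j => Var j)) (index_enum 'I_(arity f)) v.
apply; first exact: index_enum_uniq.
by move=> x _; exact: mem_index_enum.
Qed.

Lemma eval_app_affine (A : algebra sg) (VA : V A) (z : A) X (f : sg)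
    (args : 'I_(arity f) -> term sg X) (v : X -> A) :
  eval v (App args) =
  \sum_i op_coef i *: (eval v (args i) : pointed hm hab VA z) +
  op (a := A) (fun _ : 'I_(arity f) => z)
  :> pointed hm hab VA z.
Proof. exact: (@op_affine _ VA z f (fun i => eval v (args i))). Qed.

Lemma op_coef_scale (A : algebra sg) (VA : V A) (z : A) (f : sg)
    (i : 'I_(arity f)) (a : pointed hm hab VA z) :
  op_coef i *: a = (op (a := A) (at_var z i (a : A)) : pointed hm hab VA z)
                  - (op (a := A) (fun _ : 'I_(arity f) => z) : pointed hm hab VA z).
Proof. exact: coef_scale. Qed.

Local Notation VF2 := (free_in_variety hV vz).
Local Notation PF2 := (pointed hm hab VF2 (z2 V)).

Lemma val_sum I (r : seq I) (F : I -> R) :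
  val (\sum_(i <- r) F i) = \sum_(i <- r) (val (F i) : PF2) :> PF2.
Proof. by apply: (big_morph (val : R -> PF2)). Qed.

(** The chain rule: in the difference that defines a coefficient, the constant of [f] cancels. *)
Lemma coef_app (X : eqType) f (args : 'I_(arity f) -> term sg X) x :
  coef (App args) x = \sum_i op_coef i * coef (args i) x.
Proof.
apply: val_inj; rewrite (val_sum _ (fun i => op_coef i * coef (args i) x)).
(* The product of the ring is by definition its action on the free algebra pointed at [z2]. *)
transitivity (\sum_i op_coef i *: (val (coef (args i) x) : PF2) : PF2); last by [].
have cE t : val (coef t x) =
    (eval (A := F2 V) (at_var (z2 V) x (x2 V)) t : PF2) -
     (eval (A := F2 V) (fun=> z2 V) t : PF2) :> PF2.
  by rewrite -[RHS]addr0 -(@pointed_maltsev _ VF2 (z2 V)).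
rewrite cE !(@eval_app_affine _ VF2 (z2 V)) opprD addrACA subrr addr0 -sumrB.
by apply: eq_bigr => i _; rewrite cE scalerBr.
Qed.

Lemma coef_var (X : eqType) (x y : X) :
  coef (Var y) x = (y == x)%:R.
Proof.
apply: val_inj; rewrite /= /coef_fun /= /at_var.
by case: eqP => _ /=; exact: (@maltsev_r (F2 V) VF2).
Qed.

(** Since r(z,z) = z, nothing is subtracted. Thus every ring element is itself a coefficient of a
    term. *)
Lemma coef_repr (r : R) : coef (repr (val r)) vx = r.
Proof.
apply: val_inj => /=; rewrite /coef_fun.
have -> : eval (A := F2 V) (fun=> z2 V) (repr (val r)) = z2 V.
  have {2}<- := at2_idem VF2 r (z2 V).
  by rewrite /at2; congr eval; apply: funext => -[].
have -> : eval (A := F2 V) (at_var (z2 V) vx (x2 V)) (repr (val r)) = val r.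
  by rewrite -{2}(at2_eta (val r)) /at2; congr eval; apply: funext => -[];
     rewrite /at_var; case: eqP.
exact: (maltsev_r VF2).
Qed.

(** By [coef_repr] it suffices to treat coefficients of terms, which the chain rule builds from
    those of the basic operations. *)
Lemma ring_generated (P : set R) : subring P ->
  (forall f (i : 'I_(arity f)), P (op_coef i)) -> forall r, P r.
Proof.
move=> hP hg r; rewrite -(coef_repr r); elim: (repr _) => [y|f args IH].
  rewrite coef_var; case: (y == vx); last exact: subring0.
  by case: hP.
rewrite coef_app; apply: (subring_sum hP) => i.
by case: hP => _ _; apply; [exact: hg|exact: IH].
Qed.

Local Notation M := (unary_module hm hab).
Local Notation VF1 := (free_in_variety hV tt).
Local Notation PF1 := (pointed hm hab VF1 (z1 V)).

Definition const_part X (t : term sg X) : M := eval (A := F1 V) (fun=> z1 V) t.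

Definition op_const (f : sg) : M := op (a := F1 V) (fun _ : 'I_(arity f) => z1 V).

Lemma const_part_app X f (args : 'I_(arity f) -> term sg X) :
  const_part (App args) =
  \sum_i op_coef i *: const_part (args i) + op_const f.
Proof. exact: (@eval_app_affine _ VF1 (z1 V)). Qed.

Lemma const_part_repr (u : M) : const_part (repr u) = u.
Proof.
by rewrite /const_part -[RHS]reprK eval_free; congr (\pi); elim: (repr u) => [[]|f a IH] //=;
  congr App; apply: funext => i.
Qed.

(** A unary term is its own constant part, and [const_part_app] builds constant parts from the
    elements f(z,..,z). *)
Lemma module_generated (N : set M) : submodule N ->
  (forall f, N (op_const f)) -> forall u, N u.
Proof.
move=> [h0 hD hZ] hg u; rewrite -(const_part_repr u); elim: (repr _) => [y|f args IH].
  exact: h0.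
rewrite const_part_app; apply: (hD) => //; apply: big_ind => // i _.
by apply: hZ; exact: IH.
Qed.
End Variety.

(** * Kernels onto finitely presented rings and modules *)

Lemma ideal_generated_ideal (R : pzRingType) (S : set R) :
  two_sided_ideal (ideal_generated S).
Proof.
split=> [I [] //|a b ha hb I hI SI|a b c hb I hI SI].
  by case: (hI) => _ h _; apply: h; [exact: ha|exact: hb].
by case: (hI) => _ _; apply; exact: hb.
Qed.

Lemma ideal_generated_sub (R : pzRingType) (S : set R) : S `<=` ideal_generated S.
Proof. by move=> s Ss I _; apply. Qed.

Lemma submodule_generated_submodule (R : pzRingType) (M : lmodType R) (S : set M) :
  submodule (submodule_generated S).
Proof.
split=> [N [] //|u v hu hv N hN SN|r u hu N hN SN].
  by case: (hN) => _ h _; apply: h; [exact: hu|exact: hv].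
by case: (hN) => _ _; apply; exact: hu.
Qed.

Lemma submodule_generated_sub (R : pzRingType) (M : lmodType R) (S : set M) :
  S `<=` submodule_generated S.
Proof. by move=> s Ss I _; apply. Qed.

Section IdealFacts.
Variables (R : pzRingType) (I : set R).
Hypothesis hI : two_sided_ideal I.

Lemma two_sided_idealMl a b : I b -> I (a * b).
Proof. by case: hI => _ _ h /(h a b 1); rewrite mulr1. Qed.
Lemma two_sided_idealMr a b : I b -> I (b * a).
Proof. by case: hI => _ _ h /(h 1 b a); rewrite mul1r. Qed.
Lemma two_sided_idealN a : I a -> I (- a).
Proof. by rewrite -mulN1r; exact: two_sided_idealMl. Qed.
Lemma two_sided_idealB a b : I a -> I b -> I (a - b).
Proof. by move=> ha /two_sided_idealN hb; case: hI => _ h _; exact: h. Qed.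
End IdealFacts.

Section SubmoduleFacts.
Variables (R : pzRingType) (M : lmodType R) (N : set M).
Hypothesis hN : submodule N.

Lemma submoduleN a : N a -> N (- a).
Proof. by rewrite -scaleN1r; case: hN => _ _; apply. Qed.
Lemma submoduleB a b : N a -> N b -> N (a - b).
Proof. by move=> ha /submoduleN hb; case: hN => _ h _; exact: h. Qed.
Lemma submodule_sum I (r : seq I) (F : I -> M) :
  (forall i, N (F i)) -> N (\sum_(i <- r) F i).
Proof. by move=> h; case: hN => h0 hD _; apply: big_ind. Qed.
End SubmoduleFacts.

Lemma kernel_ideal (R S : pzRingType) (f : {rmorphism R -> S}) (I : set S) :
  two_sided_ideal I -> two_sided_ideal [set a | I (f a)].
Proof.
case=> h0 hD hM; split=> [|a b|a b c] /=; first by rewrite rmorph0.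
  by rewrite rmorphD; exact: hD.
by rewrite !rmorphM; exact: hM.
Qed.

Lemma zero_ideal (R : pzRingType) : two_sided_ideal [set 0 : R].
Proof.
split=> [//|a b /= -> ->|a b c /= ->]; first by rewrite addr0.
by rewrite mulr0 mul0r.
Qed.

(** The presentation of [R] lifts to a map [psi] into [R1]. The set [K] consists of the lifted
    relators and of differences that express each generator of [R1] through [psi]; modulo [K], the
    ring [R1] is then presented as [R] is. *)
Lemma finitely_generated_ring_kernel (R1 R : pzRingType)
    (theta : {rmorphism R1 -> R}) (G : set R1) :
  finite_set G -> (forall P, subring P -> G `<=` P -> forall r, P r) ->
  (forall r, exists r1, theta r1 = r) -> finitely_presented_ring R ->
  exists K : set R1, [/\ finite_set K, forall k, K k -> theta k = 0
    & forall r, theta r = 0 -> ideal_generated K r].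
Proof.
move=> finG genG surj [n [phi [S [finS surjphi kerphi]]]].
have [T hT] := choice (fun i => surj (phi (free_ring_gen i))).
have [w hw] := choice (fun g => surjphi (theta g)).
pose psi : {rmorphism free_ring n -> R1} := free_ring_eval T.
have hpsi a : theta (psi a) = phi a.
  apply: (@free_ring_ext n R (theta \o psi) phi) => i /=.
  by rewrite free_ring_eval_gen hT.
pose K := psi @` S `|` (fun g => g - psi (w g)) @` G.
have hK k : K k -> theta k = 0.
  case=> [[s Ss <-]|[g Gg <-]].
    by rewrite hpsi; apply/kerphi; exact: ideal_generated_sub.
  by rewrite rmorphB hpsi hw subrr.
exists K; split=> //.
  by rewrite finite_setU; split; exact: finite_image.
have hJ := ideal_generated_ideal K; set J := ideal_generated K in hJ *.
have [J0 JD JM] := hJ.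
have Jtheta r : J r -> theta r = 0.
  move=> Jr; apply: (Jr [set r | theta r = 0]) => //.
  exact: (kernel_ideal _ (@zero_ideal R)).
(* Modulo [J] every element comes from the free ring: such elements form a subring, which contains
   [G] by the choice of [K]. *)
have dense r : exists a, J (r - psi a).
  apply: (genG [set r | exists a, J (r - psi a)]).
    split=> [|r1 s [a ha] [b hb]|r1 s [a ha] [b hb]] /=.
    - by exists 1; rewrite rmorph1 subrr.
    - exists (a - b); have := two_sided_idealB hJ ha hb.
      have -> // : r1 - s - psi (a - b) = r1 - psi a - (s - psi b).
      by rewrite rmorphB !opprB addrACA [RHS]addrACA [- s + _]addrC.
    exists (a * b); rewrite rmorphM.
    have -> : r1 * s - psi a * psi b = r1 * (s - psi b) + (r1 - psi a) * psi b.
      by rewrite mulrBr mulrBl addrA subrK.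
    by apply: JD; [exact: (two_sided_idealMl hJ)|exact: (two_sided_idealMr hJ)].
  move=> g Gg; exists (w g); apply: ideal_generated_sub; right.
  by exists g.
move=> r hr; have [a ha] := dense r.
(* Both [r] and [r - psi a] are killed by [theta], so [a] is a consequence of the relators, and
   [psi] carries these into [J]. *)
have /kerphi pa : phi a = 0.
  by move: (Jtheta _ ha); rewrite rmorphB hr sub0r hpsi => /eqP; rewrite oppr_eq0 => /eqP.
rewrite -(subrK (psi a) r); apply: (JD) => //.
apply: (pa [set a | J (psi a)]); first exact: kernel_ideal.
by move=> s Ss; apply: ideal_generated_sub; left; exists s.
Qed.

(** The argument for rings, across a change of scalars: [theta] is bijective, so a presentation over
    [R] can be read over [R0]. *)
Lemma finitely_generated_module_kernel (R0 R : pzRingType)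
    (theta : {rmorphism R0 -> R}) (M0 : lmodType R0) (M : lmodType R)
    (eta : {additive M0 -> M}) (G : set M0) :
  injective theta -> (forall r, exists r0, theta r0 = r) ->
  (forall r u, eta (r *: u) = theta r *: eta u) ->
  finite_set G -> (forall N, submodule N -> G `<=` N -> forall u, N u) ->
  (forall u, exists u0, eta u0 = u) -> finitely_presented_module M ->
  exists K : set M0, [/\ finite_set K, forall k, K k -> eta k = 0
    & forall u, eta u = 0 -> submodule_generated K u].
Proof.
move=> inj surjt etaZ finG genG surj [n [phi [S [finS surjphi kerphi]]]].
have [T hT] := choice (fun i => surj (phi (delta_mx 0 i))).
have [w hw] := choice (fun g => surjphi (eta g)).
(* The inverse of [theta]; injectivity makes it additive and multiplicative, so [psi] is
   semilinear. *)
have [q hq] := choice surjt.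
have qD a b : q (a + b) = q a + q b by apply: inj; rewrite rmorphD !hq.
have qM a b : q (a * b) = q a * q b by apply: inj; rewrite rmorphM !hq.
have q0 : q 0 = 0 by apply: inj; rewrite hq rmorph0.
pose psi (a : 'rV[R]_n) : M0 := \sum_i q (a 0 i) *: T i.
have psi0 : psi 0 = 0.
  by rewrite /psi big1 // => i _; rewrite mxE q0 scale0r.
have psiD a b : psi (a + b) = psi a + psi b.
  by rewrite /psi -big_split; apply: eq_bigr => i _; rewrite mxE qD scalerDl.
have psiZ r a : psi (r *: a) = q r *: psi a.
  by rewrite /psi scaler_sumr; apply: eq_bigr => i _; rewrite mxE qM scalerA.
have psiN a : psi (- a) = - psi a.
  by apply: (addrI (psi a)); rewrite -psiD !subrr psi0.
have hpsi a : eta (psi a) = phi a.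
  rewrite {2}(row_sum_delta a) raddf_sum linear_sum; apply: eq_bigr => i _.
  by rewrite etaZ hq hT linearZ.
pose K := psi @` S `|` (fun g => g - psi (w g)) @` G.
have hK k : K k -> eta k = 0.
  case=> [[s Ss <-]|[g Gg <-]].
    by rewrite hpsi; apply/kerphi; exact: submodule_generated_sub.
  by rewrite raddfB hpsi hw subrr.
exists K; split=> //.
  by rewrite finite_setU; split; exact: finite_image.
have hJ := submodule_generated_submodule K; set J := submodule_generated K in hJ *.
have [J0 JD JZ] := (hJ : submodule J).
have Jeta r : J r -> eta r = 0.
  move=> Jr; apply: (Jr [set r | eta r = 0]) => //.
  split=> [|u v /= hu hv|r' u /= hu] /=; first by rewrite raddf0.
    by rewrite raddfD hu hv addr0.
  by rewrite etaZ hu scaler0.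
have dense r : exists a, J (r - psi a).
  apply: (genG [set r | exists a, J (r - psi a)]).
    split=> [|r1 s [a ha] [b hb]|r1 u [a ha]] /=.
    - by exists 0; rewrite psi0 subrr.
    - by exists (a + b); rewrite psiD opprD addrACA; exact: JD.
    exists (theta r1 *: a); rewrite psiZ.
    have -> : q (theta r1) = r1 by apply: inj; rewrite hq.
    by rewrite -scalerBr; exact: JZ.
  move=> g Gg; exists (w g); apply: submodule_generated_sub; right.
  by exists g.
move=> r hr; have [a ha] := dense r.
have /kerphi pa : phi a = 0.
  by move: (Jeta _ ha); rewrite raddfB hr sub0r hpsi => /eqP; rewrite oppr_eq0 => /eqP.
rewrite -(subrK (psi a) r); apply: (JD) => //.
apply: (pa [set a | J (psi a)]); last first.
  by move=> s Ss; apply: submodule_generated_sub; left; exists s.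
split=> [|u v /= hu hv|r' u /= hu] /=; first by rewrite psi0.
  by rewrite psiD; exact: JD.
by rewrite psiZ; exact: JZ.
Qed.

(** * Comparison of abelian Mal'cev varieties *)

Definition models (sg : signature) (E : set (equation sg)) (A : algebra sg) : Prop :=
  forall e, E e -> satisfies A e.1 e.2.

Lemma models_variety sg (E : set (equation sg)) : is_variety (models E).
Proof. by exists E. Qed.

Section Compare.
Variables (sg : signature) (V V' : algebra sg -> Prop).
Hypothesis sub : forall A, V A -> V' A.
Variable m : term sg 'I_3.
Hypotheses (hm : maltsev_term V m) (hab : abelian V) (hV : is_variety V).
Hypotheses (hm' : maltsev_term V' m) (hab' : abelian V') (hV' : is_variety V').
Local Notation R := (binary_ring hm hab).
Local Notation M := (unary_module hm hab).
Local Notation R' := (binary_ring hm' hab').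
Local Notation M' := (unary_module hm' hab').

Definition compare X (t : free V' X) : free V X :=
  \pi_(free V X) (repr t).

(** Identities of the larger class [V'] hold in [V], so the chosen representative is immaterial. *)
Lemma compare_pi X (t : term sg X) : compare (\pi_(free V' X) t) = \pi_(free V X) t.
Proof. by apply/piP => A /sub VA v; rewrite repr_pi. Qed.

Lemma compare_eval X Y (y0 : Y) (u : X -> free V' Y) (t : term sg X) :
  compare (eval (A := free_algebra V' y0) u t) =
  eval (A := free_algebra V y0) (fun x => compare (u x)) t.
Proof. by rewrite eval_free_repr compare_pi eval_free. Qed.

Lemma compare_m3 Y (y0 : Y) (a b c : free V' Y) :
  compare (m3 (A := free_algebra V' y0) m a b c) =
  m3 (A := free_algebra V y0) m (compare a) (compare b) (compare c).
Proof. by rewrite /m3 compare_eval (triple_map (fun u => compare u)). Qed.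

Lemma compare_at2 Y (y0 : Y) (r : free V' xz) (a b : free V' Y) :
  compare (at2 (A := free_algebra V' y0) r a b) =
  at2 (A := free_algebra V y0) (compare r) (compare a) (compare b).
Proof.
rewrite /at2 compare_eval [RHS]repr_pi_free; 
by apply: (congr1 (fun v : xz -> free_algebra V y0 => eval v (repr r)));
   apply: funext => -[].
Qed.

Lemma compare_idem (r : R') : idempotent (compare (val r)).
Proof.
apply/eqP; have /eqP/(congr1 (fun u => compare u)) := valP r.
by rewrite compare_at2 compare_pi.
Qed.

Definition compare_ring (r : R') : R := Sub (compare (val r)) (compare_idem r).

Fact compare_ring_nmod : nmod_morphism compare_ring.
Proof.
split=> [|r s]; apply: val_inj; first exact: compare_pi.
by rewrite /= compare_m3 compare_pi.
Qed.

Fact compare_ring_monoid : monoid_morphism compare_ring.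
Proof.
split=> [|r s]; apply: val_inj; first exact: compare_pi.
by rewrite /= compare_at2 compare_pi.
Qed.

HB.instance Definition _ :=
  GRing.isNmodMorphism.Build R' R compare_ring compare_ring_nmod.
HB.instance Definition _ :=
  GRing.isMonoidMorphism.Build R' R compare_ring compare_ring_monoid.

Lemma compare_coef (X : eqType) (t : term sg X) x :
  compare_ring (coef hm' hab' hV' t x) = coef hm hab hV t x.
Proof.
have hv : (fun y => compare (at_var (z2 V') x (x2 V') y)) =
    at_var (z2 V) x (x2 V).
  by apply: funext => y; rewrite /at_var; case: ifP; rewrite compare_pi.
apply: val_inj; rewrite /= /coef_fun compare_m3 !compare_eval hv.
by rewrite /z2 !compare_pi.
Qed.

Lemma compare_ring_surj (r : R) : exists r', compare_ring r' = r.
Proof. by exists (coef hm' hab' hV' (repr (val r)) vx); rewrite compare_coef coef_repr. Qed.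

(** The inclusion is an argument so that the additive structure, whose proof uses it, can be
    attached to the map. *)
Definition compare_module of (forall A, V A -> V' A) : M' -> M := @compare unit.

Fact compare_module_nmod : nmod_morphism (compare_module sub).
Proof.
split=> [|r s]; first exact: compare_pi.
by rewrite /compare_module compare_m3 compare_pi.
Qed.

HB.instance Definition _ :=
  GRing.isNmodMorphism.Build M' M (compare_module sub) compare_module_nmod.

Lemma compare_moduleZ (r : R') (u : M') :
  compare_module sub (r *: u) = compare_ring r *: compare_module sub u.
Proof. by rewrite /compare_module compare_at2 compare_pi. Qed.

Lemma compare_module_surj (u : M) : exists u', compare_module sub u' = u.
Proof.
by exists (\pi_(free V' unit) (repr u)); rewrite /compare_module compare_pi reprK.
Qed.

Lemma const_part_pi X (t : term sg X) :
  const_part hm' hab' t = \pi_(free V' unit) (subst (fun=> Var tt) t).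
Proof. exact: eval_free. Qed.

(** The two sides of an identity of [V] have equal coefficients and constant parts over [V], hence
    over [V'] by injectivity; the affine form then makes them equal in every member of [V']. *)
Lemma variety_sub_of_compare_inj :
  injective compare_ring -> injective (compare_module sub) ->
  forall A, V' A -> V A.
Proof.
move=> injR injM A V'A; case: (hV) => E hE; apply/hE => -[s t] Est /= v.
have Vst B : V B -> satisfies B s t by move=> /hE/(_ _ Est).
pose r := undup (vars s ++ vars t).
have rs : {subset vars s <= r} by move=> x xs; rewrite mem_undup mem_cat xs.
have rt : {subset vars t <= r} by move=> x xt; rewrite mem_undup mem_cat xt orbT.
have ur : uniq r := undup_uniq _.
(* Any element can serve as base point; the value of variable 0 is one at hand. *)
rewrite (@eval_affine _ _ _ hm' hab' hV' _ _ V'A (v 0%N) s r v ur rs).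
rewrite (@eval_affine _ _ _ hm' hab' hV' _ _ V'A (v 0%N) t r v ur rt).
have -> : eval (fun=> v 0%N) s = eval (fun=> v 0%N) t.
  have : const_part hm' hab' s = const_part hm' hab' t.
    apply: injM; rewrite !const_part_pi /compare_module !compare_pi.
    by apply/piP => B VB w; rewrite !eval_subst; exact: Vst.
  rewrite !const_part_pi => /piP/(_ A V'A (fun=> v 0%N)).
  by rewrite !eval_subst.
have coefE x : coef hm' hab' hV' s x = coef hm' hab' hV' t x.
  by apply: injR; rewrite !compare_coef; exact: coef_satisfies.
by under eq_bigr do rewrite coefE.
Qed.

End Compare.

(** * Equations for abelian Mal'cev algebras *)

(** Equality is a congruence modulo which the term condition holds, so the commutator lies below
    it. *)
Lemma abelian_of_maltsev_commutes (sg : signature) (A : algebra sg)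
    (m : term sg 'I_3) :
  (forall x y : A, m3 m x x y = y /\ m3 m y x x = y) ->
  (forall (f : sg) (a b c : 'I_(arity f) -> A),
     op (fun i => m3 m (a i) (b i) (c i)) = m3 m (op a) (op b) (op c)) ->
  abelian_algebra A.
Proof.
move=> hm hop a b; split=> [|-> delta [] //]; apply.
  by split=> [//|//|x y z -> //|f u v /funext ->].
have comm X (t : term sg X) (u v w : X -> A) :
    eval (fun x => m3 m (u x) (v x) (w x)) t = m3 m (eval u t) (eval v t) (eval w t).
  elim: t => //= f args IH; rewrite -hop; congr op; apply: funext => i; exact: IH.
move=> p q t u v c d _ _ /= e.
(* t(v, c) = m(t(u, c), t(u, d), t(v, d)), computed coordinatewise. *)
set vc := fun k => _; set vd := fun k => _.
pose ev (u : 'I_p -> A) (c : 'I_q -> A) :=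
  fun k : 'I_p + 'I_q => match k with inl i => u i | inr j => c j end.
rewrite -/(ev u c) -/(ev u d) in e; rewrite -/(ev v c) -/(ev v d) in vc vd *.
transitivity (eval (fun k => m3 m (ev u c k) (ev u d k) (ev v d k)) t).
  congr eval; apply: funext => -[i|j] /=; first by have [] := hm (u i) (v i).
  by have [] := hm (d j) (c j).
by rewrite comm e; have [] := hm (eval (ev u d) t) (eval (ev v d) t).
Qed.

Section NatEquation.
Variables (sg : signature) (X : countType).

Definition nat_equation (s t : term sg X) : equation sg :=
  (subst (fun x : X => Var (choice.pickle x)) s, subst (fun x : X => Var (choice.pickle x)) t).

Lemma nat_equationP (A : algebra sg) (s t : term sg X) :
  satisfies A (nat_equation s t).1 (nat_equation s t).2 <-> satisfies A s t.
Proof.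
split=> h v; last by rewrite /= !eval_subst; exact: h.
have [a0] := carrier_nonempty A.
(* Numbers that code no variable get the default [a0], available because algebras are nonempty. *)
have := h (fun k => if choice.unpickle k is Some x then v x else a0).
by rewrite /= !eval_subst /=; under eq_fun do rewrite choice.pickleK.
Qed.
End NatEquation.

Section MaltsevBasis.
Variables (sg : signature) (m : term sg 'I_3).

(** The variables form an array with three rows and one column per argument of [f]. *)
Definition commute_equation (f : sg) : equation sg :=
  nat_equation (X := ('I_3 * 'I_(arity f))%type)
    (App (fun i => subst (fun j => Var (j, i)) m))
    (subst (fun j => App (fun i => Var (j, i))) m).

Definition abelian_maltsev_basis : set (equation sg) :=
  [set (subst (triple (Var 0) (Var 0) (Var 1)) m, Var 1);
       (subst (triple (Var 1) (Var 0) (Var 0)) m, Var 1)] `|`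
  range commute_equation.

Lemma abelian_maltsev_basis_finite : finite_type sg -> finite_set abelian_maltsev_basis.
Proof.
by move=> fin; rewrite finite_setU; split; [exact: finite_set2|exact: finite_image].
Qed.

Lemma commute_equationP (A : algebra sg) (f : sg) :
  satisfies A (commute_equation f).1 (commute_equation f).2 <->
  forall a b c : 'I_(arity f) -> A,
     op (fun i => m3 m (a i) (b i) (c i)) = m3 m (op a) (op b) (op c).
Proof.
rewrite nat_equationP; split=> [h a b c|h v].
  have := h (fun ji => triple a b c ji.1 ji.2); rewrite /= eval_subst /=.
  under eq_fun do rewrite eval_subst /=.
  rewrite /m3 => e; transitivity (op (fun i => eval (fun j => triple a b c j i) m)).
    congr op; apply: funext => i; congr eval.
    by rewrite -(triple_map (fun g => g i)).
  by rewrite e; congr eval; rewrite -(triple_map (fun g => op g)).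
pose w j := fun i => v (j, i).
have hw : triple (w (inord 0)) (w (inord 1)) (w (inord 2)) = w.
  apply: funext => -[[|[|[|//]]] hj]; congr w; apply: val_inj;
  by rewrite /= inordK.
rewrite /= eval_subst /=.
under eq_fun do rewrite eval_subst /=.
have := h (w (inord 0)) (w (inord 1)) (w (inord 2)).
rewrite /m3 -(triple_map (fun g => op g)) hw => <-.
by congr op; apply: funext => i; rewrite -(triple_map (fun g => g i)) hw.
Qed.

Lemma maltsev_basis_maltsev (V : algebra sg -> Prop) :
  (forall A, V A -> models abelian_maltsev_basis A) -> maltsev_term V m.
Proof.
move=> h A /h hA x y; pose v n := if n is 0%N then x else y.
have e1 := hA _ (or_introl (or_introl erefl)) v.
have e2 := hA _ (or_introl (or_intror erefl)) v.
by move: e1 e2; rewrite /= !eval_subst !triple_map.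
Qed.

Lemma maltsev_basis_abelian (V : algebra sg -> Prop) :
  (forall A, V A -> models abelian_maltsev_basis A) -> abelian V.
Proof.
move=> h A VA; apply: (@abelian_of_maltsev_commutes _ _ m).
  exact: (maltsev_basis_maltsev h).
move=> f; apply/commute_equationP/(h _ VA); right; by exists f.
Qed.

Lemma maltsev_basis_models (V : algebra sg -> Prop) :
  maltsev_term V m -> abelian V ->
  forall A, V A -> models abelian_maltsev_basis A.
Proof.
move=> hm hab A VA e [[->|->] v|[f _ <-]].
- by rewrite /= eval_subst triple_map; have [] := hm A VA (v 0%N) (v 1%N).
- by rewrite /= eval_subst triple_map; have [] := hm A VA (v 0%N) (v 1%N).
by apply/commute_equationP => a b c; exact: (maltsev_op hm hab VA).
Qed.

End MaltsevBasis.

(** * From finite presentations to a finite basis *)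

Lemma finite_sigma (T : Type) (n : T -> nat) : finite_set [set: T] ->
  finite_set [set: {x : T & 'I_(n x)}].
Proof.
move=> finT; apply: (@sub_finite_set _ _
  (\bigcup_(x in [set: T]) range (fun i : 'I_(n x) => existT (fun x => 'I_(n x)) x i))).
  by move=> [x i] _; exists x => //; exists i.
by apply: bigcup_finite => // x _; apply: finite_image; exact: finite_finset.
Qed.

Lemma compare_comp (sg : signature) (V V' V'' : algebra sg -> Prop) X
    (u : free V'' X) : (forall A, V A -> V' A) ->
  compare V (compare V' u) = compare V u.
Proof. by move=> sub; rewrite {2}/compare compare_pi. Qed.

Lemma finitely_based_of_presentations (sg : signature) (V : algebra sg -> Prop)
    (hV : is_variety V) (m : term sg 'I_3) (hm : maltsev_term V m)
    (hab : abelian V) :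
  finite_type sg ->
  finitely_presented_ring (binary_ring hm hab) ->
  finitely_presented_module (unary_module hm hab) ->
  finitely_based V.
Proof.
move=> fin fpR fpM.
pose E1 := abelian_maltsev_basis m; pose V1 := models E1.
have hV1 : is_variety V1 := models_variety E1.
have hm1 : maltsev_term V1 m by apply: maltsev_basis_maltsev.
have hab1 : abelian V1 by apply: (@maltsev_basis_abelian _ m).
have sub1 : forall A, V A -> V1 A := maltsev_basis_models hm hab.
pose theta1 := @compare_ring _ _ _ sub1 _ hm hab hm1 hab1.
pose G1 := range (fun fi : {f : sg & 'I_(arity f)} =>
  op_coef hm1 hab1 hV1 (tagged fi)).
have finG1 : finite_set G1 by apply: finite_image; exact: finite_sigma.
have genG1 P : subring P -> G1 `<=` P -> forall r, P r.
  move=> hP GP; apply: (ring_generated hP) => f i; apply: GP.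
  by exists (existT _ f i).
have [K1 [finK1 K1ker K1gen]] := finitely_generated_ring_kernel
  (theta := theta1) finG1 genG1 (compare_ring_surj sub1 hV hm1 hab1 hV1) fpR.
(* Each kernel generator k becomes the identity k(x,z) = z, which forces the ring of [V2] to be that
   of [V]. *)
pose E2 := E1 `|` (fun k => nat_equation (repr (val k)) (Var vz)) @` K1.
pose V2 := models E2.
have hV2 : is_variety V2 := models_variety E2.
have sub21 A : V2 A -> V1 A by move=> h e Ee; apply: h; left.
have hm2 : maltsev_term V2 m by apply: maltsev_basis_maltsev.
have hab2 : abelian V2 by apply: (@maltsev_basis_abelian _ m).
have sub2 A : V A -> V2 A.
  move=> VA e [/(sub1 _ VA)//|[k Kk <-]]; apply/nat_equationP.
  by have /(congr1 val)/piP/(_ A VA) := K1ker _ Kk.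
pose theta2 := @compare_ring _ _ _ sub2 _ hm hab hm2 hab2.
pose theta21 := @compare_ring _ _ _ sub21 _ hm2 hab2 hm1 hab1.
have inj2 : injective theta2.
  apply: raddf_inj => r2.
  (* Lifted to [r1] over [V1], the element lies in the ideal generated by [K1], which [theta21]
     kills because of the identities added in [E2]. *)
  have [r1 <-] := compare_ring_surj sub21 (hm := hm2) (hab := hab2) hV2 hm1 hab1 hV1 r2.
  move=> /(congr1 val) e; have /K1gen : theta1 r1 = 0.
    by apply: val_inj; rewrite -[RHS]e /= compare_comp.
  move=> /(_ [set r | theta21 r = 0]); apply.
    exact: (kernel_ideal _ (@zero_ideal _)).
  move=> k Kk; apply: val_inj => /=; apply/piP => A V2A.
  by apply/nat_equationP; apply: V2A; right; exists k.
pose eta2 := @compare_module _ _ _ _ hm hab hm2 hab2 sub2.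
pose G2 := range (op_const hm2 hab2).
have finG2 : finite_set G2 by exact: finite_image.
have genG2 N : submodule N -> G2 `<=` N -> forall u, N u.
  move=> hN GN; apply: (module_generated hV2 hN) => f; apply: GN.
  by exists f.
(* The ring is settled first because this step needs [theta2] to be bijective. *)
have [K2 [finK2 K2ker K2gen]] := finitely_generated_module_kernel
  (theta := theta2) (eta := eta2) inj2 (compare_ring_surj sub2 hV hm2 hab2 hV2)
  (compare_moduleZ sub2 hm hab (hm' := hm2) (hab' := hab2)) finG2 genG2
  (compare_module_surj sub2 hm2 hab2) fpM.
pose E3 := E2 `|` (fun k : free V2 unit => nat_equation (repr k) (Var tt)) @` K2.
pose V3 := models E3.
have hV3 : is_variety V3 := models_variety E3.
have sub32 A : V3 A -> V2 A by move=> h e Ee; apply: h; left.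
have hm3 : maltsev_term V3 m.
  by apply: maltsev_basis_maltsev => A /sub32/sub21.
have hab3 : abelian V3 by move=> A /sub32/hab2.
have sub3 A : V A -> V3 A.
  move=> VA e [/(sub2 _ VA)//|[k Kk <-]]; apply/nat_equationP.
  by have /piP/(_ A VA) := K2ker _ Kk.
exists E3; split.
  rewrite finite_setU; split; last exact: finite_image.
  rewrite finite_setU; split; last exact: finite_image.
  exact: abelian_maltsev_basis_finite.
move=> A; split; first exact: sub3.
apply: (variety_sub_of_compare_inj (hm := hm) (hm' := hm3) (hab := hab)
  (hab' := hab3) hV hV3 (sub := sub3)).
  (* The ring of [V3] lies between those of [V2] and [V]: an element killed in the latter lifts to
     the kernel of [theta2], which is zero. *)
  apply: raddf_inj => r3.
  have [r2 <-] := compare_ring_surj sub32 (hm := hm3) (hab := hab3) hV3 hm2 hab2 hV2 r3.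
  move=> /(congr1 val) e; have : theta2 r2 = theta2 0.
    have -> : theta2 0 = 0 by exact: raddf0.
    by apply: val_inj; rewrite -[RHS]e /= compare_comp.
  by move=> /inj2 ->; exact: raddf0.
apply: raddf_inj => u3.
have [u2 <-] := compare_module_surj sub32 (hm := hm3) (hab := hab3) hm2 hab2 u3.
move=> e; have /K2gen : eta2 u2 = 0.
  by rewrite -[RHS]e; symmetry; exact: (compare_comp u2 sub3).
pose eta32 := @compare_module _ _ _ _ hm3 hab3 hm2 hab2 sub32.
move=> /(_ [set u | eta32 u = 0]); apply.
  split=> [|u v hu hv|r u hu] /=; first exact: raddf0.
    have -> : eta32 (u + v) = eta32 u + eta32 v by exact: raddfD.
    by rewrite hu hv addr0.
  by rewrite /eta32 compare_moduleZ -/(eta32 u) hu scaler0.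
move=> k Kk /=; apply/piP => B V3B.
by apply/nat_equationP; apply: V3B; right; exists k.
Qed.

(** * Affine algebras over formal coefficients *)

(** Symbols carry no decidable equality, hence the detour through [{classic T}]. *)
Lemma finite_ord_bij (T : Type) : finite_set [set: T] ->
  exists (n : nat) (e : T -> 'I_n) (d : 'I_n -> T), cancel e d /\ cancel d e.
Proof.
move=> /(@finite_seqP {classic T})[s sT].
pose s' := undup s.
have s'T (x : {classic T}) : x \in s'.
  by rewrite mem_undup; have : [set: {classic T}] x by []; rewrite sT.
have lt (x : {classic T}) : (index x s' < size s')%N by rewrite index_mem.
exists (size s'), (fun x => Ordinal (lt x)), (fun i => tnth (in_tuple s') i); split.
  by move=> x; rewrite (tnth_nth x) /=; exact: (nth_index (T := {classic T})).
move=> i; apply: val_inj => /=; rewrite (tnth_nth (tnth (in_tuple s') i)) /=.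
by rewrite index_uniq // undup_uniq.
Qed.

Section QuotientAlgebra.
Variables (sg : signature) (A : algebra sg) (delta : A -> A -> Prop).
Hypothesis hdelta : congruence delta.

Definition quotient_rel : rel {classic A} := fun a b => `[< delta a b >].

Lemma quotient_rel_refl : reflexive quotient_rel.
Proof. by case: hdelta => h _ _ _ a; apply/asboolP. Qed.
Lemma quotient_rel_sym : symmetric quotient_rel.
Proof. by case: hdelta => _ h _ _ a b; apply: asbool_equiv_eq; split; exact: h. Qed.
Lemma quotient_rel_trans : transitive quotient_rel.
Proof.
case: hdelta => _ _ h _ b a c /asboolP ab /asboolP bc; apply/asboolP.
exact: h bc.
Qed.

Canonical quotient_equiv :=
  EquivRel quotient_rel quotient_rel_refl quotient_rel_sym quotient_rel_trans.

Definition quotient_carrier : Type := {eq_quot quotient_rel}.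
HB.instance Definition _ := EqQuotient.on quotient_carrier.

Definition quotient_op (f : sg) (args : 'I_(arity f) -> quotient_carrier) :
    quotient_carrier :=
  \pi_quotient_carrier (op (a := A) (fun i => repr (args i))).

Definition quotient_class (a : A) : quotient_carrier := \pi_quotient_carrier a.

Fact quotient_inhabited : inhabited quotient_carrier.
Proof. by case: (carrier_nonempty A) => a; exact: (inhabits (quotient_class a)). Qed.

Definition quotient_algebra : algebra sg := Algebra quotient_op quotient_inhabited.

Lemma quotient_classP a b : quotient_class a = quotient_class b <-> delta a b.
Proof. by split=> [/eqmodP/asboolP|h]; [|apply/eqmodP/asboolP]. Qed.

Lemma quotient_classK (q : quotient_carrier) : quotient_class (repr q) = q.
Proof. exact: reprK. Qed.

Lemma op_quotient f (args : 'I_(arity f) -> A) :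
  op (a := quotient_algebra) (fun i => quotient_class (args i)) =
  quotient_class (op args).
Proof.
apply/quotient_classP; case: (hdelta) => _ _ _; apply=> i.
by apply/quotient_classP; rewrite quotient_classK.
Qed.

Lemma eval_quotient X (v : X -> A) (t : term sg X) :
  eval (A := quotient_algebra) (fun x => quotient_class (v x)) t =
  quotient_class (eval v t).
Proof.
elim: t => // f args IH; rewrite -[RHS]op_quotient.
by rewrite [LHS]/=; congr quotient_op; apply: funext => i; exact: IH.
Qed.

(** Every valuation in the quotient lifts to [A] through representatives. *)
Lemma quotient_satisfies X (s t : term sg X) :
  (forall v, delta (eval v s) (eval v t)) -> satisfies quotient_algebra s t.
Proof.
move=> h v.
have -> : v = fun x => quotient_class (repr (v x)).
  by apply: funext => x; rewrite quotient_classK.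
by rewrite !eval_quotient; apply/quotient_classP.
Qed.

End QuotientAlgebra.

Section AffineAlgebra.
Variables (sg : signature) (W : pzRingType) (M : lmodType W).
Variables (kappa : forall f : sg, 'I_(arity f) -> W) (c : sg -> M).

Definition affine_algebra : algebra sg :=
  Algebra (fun (f : sg) (a : 'I_(arity f) -> M) => \sum_i kappa i *: a i + c f)
    (inhabits (0 : M)).

(** The chain rule [coef_app] taken as a definition, with [kappa] in place of [op_coef]. *)
Fixpoint affine_coef (X : eqType) (t : term sg X) (x : X) : W :=
  match t with
  | Var y => (y == x)%:R
  | App f args => \sum_i kappa i * affine_coef (args i) x
  end.

Definition affine_const X (t : term sg X) : M :=
  eval (A := affine_algebra) (fun=> 0 : M) t.

Lemma affine_evalE (X : eqType) (t : term sg X) (r : seq X) (v : X -> M) :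
  uniq r -> {subset vars t <= r} ->
  eval (A := affine_algebra) v t =
  \sum_(x <- r) affine_coef t x *: v x + affine_const t :> M.
Proof.
move=> ur; elim: t => [y|f args IH] tr.
  rewrite /affine_const /= addr0 (bigD1_seq y) ?tr ?inE //= eqxx scale1r.
  by rewrite big1 ?addr0 // => x /negPf; rewrite eq_sym => ->; rewrite scale0r.
have -> : eval (A := affine_algebra) v (App args) =
    \sum_i kappa i *: (eval (A := affine_algebra) v (args i) : M) + c f by [].
have -> : affine_const (App args) =
    \sum_i kappa i *: affine_const (args i) + c f by [].
rewrite addrA; congr (_ + _).
rewrite (eq_bigr (fun i => \sum_(x <- r) (kappa i * affine_coef (args i) x) *: v x
    + kappa i *: affine_const (args i))); last first.
  move=> i _; rewrite IH; last by move=> x /vars_sub/tr.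
  rewrite scalerDr scaler_sumr; congr (_ + _).
  by apply: eq_bigr => x _; rewrite scalerA.
rewrite big_split exchange_big /=; congr (_ + _).
by apply: eq_bigr => x _; rewrite scaler_suml.
Qed.

Lemma affine_evalD (X : eqType) (t : term sg X) (v w : X -> M) :
  eval (A := affine_algebra) (fun x => v x + w x : M) t =
  (eval (A := affine_algebra) v t : M) - affine_const t
   + (eval (A := affine_algebra) w t : M) :> M.
Proof.
have ur := undup_uniq (vars t).
have tr : {subset vars t <= undup (vars t)} by move=> x; rewrite mem_undup.
rewrite !(affine_evalE _ ur tr) addrK addrA -big_split /=; congr (_ + _).
by apply: eq_bigr => x _; rewrite scalerDr.
Qed.

Section Quotient.
Variable N : set M.
Hypothesis hN : submodule N.

Lemma affine_congruence : congruence (A := affine_algebra) (fun u v : M => N (u - v)).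
Proof.
case: (hN) => h0 hD hZ; split=> [a|a b h|a b d hab hbd|f a b h].
- by rewrite subrr.
- by rewrite -opprB; exact: submoduleN.
- by rewrite -(subrK b a) -addrA; exact: hD.
rewrite /= opprD addrACA subrr addr0 -sumrB; apply: (submodule_sum hN) => i.
by rewrite -scalerBr; exact: hZ.
Qed.

Definition affine_quotient : algebra sg := quotient_algebra affine_congruence.
Local Notation Q := affine_quotient.

Lemma affine_quotient_satisfies (X : eqType) (s t : term sg X) :
  (forall x, x \in vars s ++ vars t ->
     forall b, N ((affine_coef s x - affine_coef t x) *: b)) ->
  N (affine_const s - affine_const t) -> satisfies Q s t.
Proof.
move=> hcoef hconst; apply: quotient_satisfies => v.
pose r := undup (vars s ++ vars t).
have rs : {subset vars s <= r} by move=> x xs; rewrite mem_undup mem_cat xs.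
have rt : {subset vars t <= r} by move=> x xt; rewrite mem_undup mem_cat xt orbT.
have ur : uniq r := undup_uniq _.
rewrite (affine_evalE v ur rs) (affine_evalE v ur rt) opprD addrACA -sumrB.
case: (hN) => h0 hD hZ; apply: (hD) => //.
rewrite big_seq; apply: big_ind => // x xr.
by rewrite -scalerBl; apply: hcoef; rewrite -mem_undup.
Qed.

Variables (V : algebra sg -> Prop) (m : term sg 'I_3).
Hypotheses (hm : maltsev_term V m) (hab : abelian V) (hV : is_variety V).
Hypothesis VQ : V Q.
Local Notation R := (binary_ring hm hab).
Local Notation cl := (quotient_class affine_congruence).
Local Notation P := (pointed hm hab VQ (cl 0)).

(** The Mal'cev identities determine an affine ternary operation. Hence the group that [m] defines
    at the class of 0 is the quotient group of the module. *)
Lemma affine_quotient_maltsev (a b d : M) :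
  m3 (A := Q) m (cl a) (cl b) (cl d) = cl (a - b + d).
Proof.
have [hl hr] := hm VQ (cl b) (cl a).
have [h0 _] := hm VQ (cl 0) (cl (d - b)).
have [hz _] := hm VQ (cl 0) (cl 0).
have E (u v w : M) : eval (A := Q) (triple (cl u) (cl v) (cl w)) m =
    cl (eval (A := affine_algebra) (triple u v w) m).
  by rewrite -eval_quotient (triple_map (fun u => cl u)).
rewrite /m3 E; apply/quotient_classP.
move: hr h0 hz; rewrite !E => /quotient_classP h1 /quotient_classP h2 /quotient_classP h3.
(* On the two summands [m] takes the values a and d - b modulo [N]; its constant part, the value at
   (0,0,0), lies in [N]. *)
have -> : triple a b d = fun i => triple a b b i + triple 0 0 (d - b) i :> M.
  by apply: funext => -[[|[|[|//]]] ?]; rewrite /triple /= ?addr0 // addrC subrK.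
rewrite affine_evalD.
have e0 : eval (A := affine_algebra) (triple 0 0 0) m = affine_const m.
  by rewrite /affine_const; congr eval; apply: funext => -[[|[|[|//]]] ?].
rewrite e0 subr0 in h3.
case: (hN) => _ hD _; have := hD _ _ (submoduleB hN h1 h3) h2.
have key (x k y : M) : x - k + y - (a - b + d) = x - a - k + (y - (d - b)).
  by rewrite [a - b + d]addrAC -[a + d - b]addrA opprD addrACA [x - k - a]addrAC.
by rewrite -key.
Qed.

Lemma affine_quotient_add (a b : M) : (cl a : P) + (cl b : P) = (cl (a + b) : P).
Proof.
rewrite -[LHS]/(m3 (A := Q) m (cl a) (cl 0) (cl b)).
by rewrite affine_quotient_maltsev subr0.
Qed.

Lemma affine_quotient_sub (a b : M) : (cl a : P) - (cl b : P) = (cl (a - b) : P).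
Proof.
rewrite -[LHS]addr0 -(@pointed_maltsev _ _ _ hm hab _ VQ (cl 0)).
by rewrite affine_quotient_maltsev addr0.
Qed.

Lemma affine_quotient_op_coef (f : sg) (i : 'I_(arity f)) (b : M) :
  op_coef hm hab hV i *: (cl b : P) = cl (kappa i *: b).
Proof.
rewrite op_coef_scale.
have -> : at_var (cl 0 : Q) i (cl b : Q) = fun j => cl (at_var 0 i b j).
  by apply: funext => j; rewrite /at_var; case: ifP.
rewrite !op_quotient affine_quotient_sub /=; congr cl.
rewrite opprD addrACA subrr addr0 -sumrB (bigD1 i) //= big1 => [|j /negPf ji].
  by rewrite /at_var eqxx scaler0 subr0 addr0.
by rewrite /at_var ji subrr.
Qed.

Variable phi : {rmorphism W -> R}.
Hypothesis phi_kappa : forall f (i : 'I_(arity f)), phi (kappa i) = op_coef hm hab hV i.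

(** It reduces to generators the claim that a formal scalar acts on the quotient as its image under
    [phi]; an element of the kernel then acts as zero. *)
Lemma affine_quotient_subring :
  subring [set a : W | forall b, phi a *: (cl b : P) = cl (a *: b)].
Proof.
split=> [b|a a' /= ha ha' b|a a' /= ha ha' b] /=.
- by rewrite rmorph1 !scale1r.
- by rewrite rmorphB [LHS]scalerBl ha ha' affine_quotient_sub -scalerBl.
by rewrite rmorphM -scalerA ha' ha scalerA.
Qed.

Lemma affine_quotient_gen f (i : 'I_(arity f)) b :
  phi (kappa i) *: (cl b : P) = cl (kappa i *: b).
Proof. by rewrite phi_kappa affine_quotient_op_coef. Qed.

Lemma phi_affine_coef (X : eqType) (t : term sg X) x :
  phi (affine_coef t x) = coef hm hab hV t x.
Proof.
elim: t => [y|f args IH]; first by rewrite coef_var /= rmorph_nat.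
rewrite coef_app /= rmorph_sum; apply: eq_bigr => i _.
by rewrite rmorphM phi_kappa IH.
Qed.

End Quotient.
End AffineAlgebra.

(** * From a finite basis to finite presentations *)

Section Presentations.
Variables (sg : signature) (V : algebra sg -> Prop) (E : set (equation sg)).
Hypotheses (hE : is_basis V E) (finE : finite_set E) (fin : finite_type sg).
Variable m : term sg 'I_3.
Hypotheses (hm : maltsev_term V m) (hab : abelian V) (hV : is_variety V).
Local Notation R := (binary_ring hm hab).
Local Notation M := (unary_module hm hab).

Lemma basis_satisfies e : E e -> forall A, V A -> satisfies A e.1 e.2.
Proof. by move=> Ee A /hE; apply. Qed.

Lemma finitely_presented_ring_of_basis : finitely_presented_ring R.
Proof.
have [n [code [decode [codeK decodeK]]]] :=
    finite_ord_bij (finite_sigma (@arity sg) fin).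
pose kappa f (i : 'I_(arity f)) : free_ring n := free_ring_gen (code (existT _ f i)).
pose phi : {rmorphism free_ring n -> R} :=
  free_ring_eval (fun j => op_coef hm hab hV (tagged (decode j))).
have phi_kappa f (i : 'I_(arity f)) : phi (kappa f i) = op_coef hm hab hV i.
  by rewrite /phi /= free_ring_eval_gen codeK.
pose S := \bigcup_(e in E)
  (fun x => affine_coef kappa e.1 x - affine_coef kappa e.2 x) @`
  [set` vars e.1 ++ vars e.2].
exists n, phi, S; split.
- by apply: bigcup_finite => // e _; apply: finite_image; exact: finite_seq.
- apply: (ring_generated (hV := hV)) => [|f i]; last by exists (kappa f i).
  split=> [|r s [a <-] [b <-]|r s [a <-] [b <-]].
  + by exists 1; rewrite rmorph1.
  + by exists (a - b); rewrite rmorphB.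
  + by exists (a * b); rewrite rmorphM.
have hN := ideal_generated_ideal S.
move=> a; split=> [pa|]; last first.
  move=> /(_ [set a | phi a = 0]); apply.
    exact: (kernel_ideal phi (@zero_ideal _)).
  move=> _ [e Ee [x _ <-]] /=.
  rewrite rmorphB !(phi_affine_coef phi_kappa).
  by rewrite (coef_satisfies _ _ _ _ (basis_satisfies Ee)) subrr.
(* The free ring is now a left module over itself, with the ideal as submodule. *)
have hN' : submodule (ideal_generated S : set (free_ring n)^o).
  case: hN => h0 hD hM; split=> // r u; exact: two_sided_idealMl.
(* With zero constants all constant parts vanish, so only coefficients have to be compared. *)
pose c (f : sg) : (free_ring n)^o := 0.
have const0 X (t : term sg X) : affine_const kappa c t = 0.
  elim: t => // f args IH; rewrite /affine_const /= addr0 big1 // => i _.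
  by rewrite [X in _ *: X]IH scaler0.
have VQ : V (affine_quotient kappa c hN').
  apply/hE => e Ee; apply: affine_quotient_satisfies; last first.
    by rewrite !const0 subrr; case: hN.
  move=> x xe b.
  have Sx : S (affine_coef kappa e.1 x - affine_coef kappa e.2 x).
    by exists e => //; exists x.
  (* A relator must annihilate the quotient module, which is where right multiples of relators
     enter. *)
  exact: (two_sided_idealMr hN b (ideal_generated_sub Sx)).
pose cl := quotient_class (affine_congruence kappa c hN').
have gens j b : phi (free_ring_gen j) *: (cl b : pointed hm hab VQ (cl 0)) =
    cl (free_ring_gen j *: b).
  have -> : free_ring_gen j = kappa _ (tagged (decode j)).
    by rewrite /kappa -[j in LHS]decodeK; case: (decode j).
  exact: (affine_quotient_gen VQ phi_kappa).
(* Applied to the class of 1: [a] acts as zero, so the class of [a] itself is zero. *)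
have := free_ring_subring (affine_quotient_subring VQ phi) gens a (1 : free_ring n).
rewrite pa scale0r => /esym/quotient_classP.
by rewrite subr0 /GRing.scale /= mulr1.
Qed.

Lemma finitely_presented_module_of_basis : finitely_presented_module M.
Proof.
have [l [code [decode [codeK decodeK]]]] := finite_ord_bij fin.
pose kappa f (i : 'I_(arity f)) := op_coef hm hab hV i.
pose c f : 'rV[R]_l := delta_mx 0 (code f).
pose psi (a : 'rV[R]_l) : M := \sum_j a 0 j *: op_const hm hab (decode j).
have psi_linear : linear psi.
  move=> r u v; rewrite /psi scaler_sumr -big_split; apply: eq_bigr => j _.
  by rewrite !mxE scalerDl scalerA.
pose psiL := GRing.isLinear.Build R 'rV[R]_l M *:%R psi psi_linear.
have [phi phiE] : exists phi : {linear 'rV[R]_l -> M}, phi =1 psi.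
  by exists (HB.pack_for {linear 'rV[R]_l -> M} psi psiL).
have phi_c f : phi (c f) = op_const hm hab f.
  rewrite phiE /psi (bigD1 (code f)) //= mxE !eqxx scale1r codeK big1 ?addr0 //.
  by move=> j /negPf jf; rewrite mxE eqxx jf scale0r.
have phi_const X (t : term sg X) : phi (affine_const kappa c t) = const_part hm hab t.
  elim: t => [x|f args IH]; first exact: raddf0.
  rewrite (const_part_app hm hab hV).
  have -> : affine_const kappa c (App args) =
    \sum_i kappa f i *: affine_const kappa c (args i) + c f by [].
  rewrite linearD phi_c linear_sum; congr (_ + _); apply: eq_bigr => i _.
  by rewrite linearZ IH.
pose S := (fun e => affine_const kappa c e.1 - affine_const kappa c e.2) @` E.
exists l, phi, S; split.
- exact: finite_image.
- apply: (module_generated hV) => [|f]; last by exists (c f).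
  split=> [|u v [a <-] [b <-]|r u [a <-]].
  + by exists 0; rewrite raddf0.
  + by exists (a + b); rewrite linearD.
  + by exists (r *: a); rewrite linearZ.
have hN := submodule_generated_submodule S.
move=> a; split=> [pa|]; last first.
  move=> /(_ [set a | phi a = 0]); apply.
    split=> [|u v /= hu hv|r u /= hu] /=; first by rewrite linear0.
      by rewrite linearD hu hv addr0.
    by rewrite linearZ /= hu scaler0.
  move=> _ [e Ee <-] /=; rewrite linearB !phi_const.
  apply/eqP; rewrite subr_eq0; apply/eqP.
  exact: (basis_satisfies Ee (free_in_variety hV tt)).
(* The scalars are already those of [V], so coefficients agree outright and the relators take care
   of the constant parts. *)
have VQ : V (affine_quotient kappa c hN).
  apply/hE => e Ee; apply: affine_quotient_satisfies; last first.
    by apply: submodule_generated_sub; exists e.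
  move=> x xe b.
  have coefE (t : term sg nat) y : affine_coef kappa t y = coef hm hab hV t y.
    exact: (phi_affine_coef (phi := idfun)).
  rewrite !coefE (coef_satisfies _ _ _ _ (basis_satisfies Ee)) subrr scale0r.
  by case: hN.
pose Q := affine_quotient kappa c hN.
pose cl : 'rV[R]_l -> Q := quotient_class (affine_congruence kappa c hN).
pose P := pointed hm hab VQ (cl 0).
(* The homomorphism from the free algebra on one generator to [Q] sending the generator to the class
   of 0. It is linear, and its composite with [phi] turns out to be the quotient map, so the kernel
   of [phi] lies in the submodule generated by [S]. *)
pose h (u : M) : P := eval (A := Q) (fun=> cl 0) (repr u).
have h_eval X (w : X -> M) (t : term sg X) :
    h (eval (A := F1 V) w t) = eval (A := Q) (fun x => h (w x) : Q) t.
  by rewrite /h eval_free_repr repr_pi // eval_subst.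
have hz : h (z1 V) = cl 0 by rewrite /h repr_pi.
have hD u v : h (u + v) = h u + h v.
  rewrite -[u + v]/(eval (A := F1 V) (triple u (z1 V) v) m) h_eval.
  by rewrite (triple_map (fun u => h u)) hz.
have hZ r u : h (r *: u) = r *: h u.
  rewrite -[r *: u]/(eval (A := F1 V) (fun i => if i is vx then u else z1 V)
    (repr (val r))) h_eval.
  rewrite pointed_scaleE /at2; congr eval; apply: funext => -[] //.
have hc f : h (op_const hm hab f) = cl (c f).
  rewrite -[op_const _ _ _]/(eval (A := F1 V) (fun _ : unit => z1 V)
    (App (fun _ : 'I_(arity f) => Var tt))) h_eval hz.
  rewrite (@eval_quotient sg _ _ (affine_congruence kappa c hN) _ (fun=> 0)) /=.
  by congr cl; rewrite big1 ?add0r // => i _; rewrite scaler0.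
have clD u v : cl (u + v) = (cl u : P) + (cl v : P).
  by rewrite affine_quotient_add.
have act r b : r *: (cl b : P) = cl (r *: b).
  apply: (ring_generated (hV := hV) (affine_quotient_subring VQ idfun)) => f i.
  exact: affine_quotient_op_coef.
have h0 : h 0 = 0 := hz.
have hphi b : h (phi b) = cl b.
  rewrite phiE /psi (big_morph h hD h0).
  rewrite {2}(row_sum_delta b).
  rewrite (big_morph (cl : _ -> P) clD erefl).
  apply: eq_bigr => j _; rewrite hZ hc act; congr cl; congr (_ *: _).
  by rewrite /c decodeK.
have : cl a = cl 0 by rewrite -hphi pa.
by move=> /quotient_classP; rewrite subr0.
Qed.
End Presentations.

(** * Finiteness of the type *)

Fixpoint symbols (sg : signature) (X : Type) (t : term sg X) : seq {classic sg} :=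
  match t with
  | Var _ => [::]
  | App f args => f :: flatten [seq symbols (args i) | i <- enum 'I_(arity f)]
  end.

Lemma symbols_sub (sg : signature) (X : Type) (f : sg)
    (args : 'I_(arity f) -> term sg X) i :
  {subset symbols (args i) <= symbols (App args)}.
Proof.
move=> g gi; rewrite inE; apply/orP; right; apply/flattenP.
exists (symbols (args i)) => //.
by apply: (map_f (fun i => symbols (args i))); rewrite mem_enum.
Qed.

Section ModifiedSquare.
Variables (sg : signature) (A : algebra sg) (f : sg) (p q : A * A).

(* The first argument is named by [exists i, i = 0], which avoids transporting
   v along g = f. *)
Definition modified_square : algebra sg :=
  Algebra (carrier := (A * A)%type) (fun g v =>
    if `[< g = f >] then
      if `[< exists i : 'I_(arity g), i = 0%N :> nat /\ v i = p >] then q else p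
    else (op (fun i => (v i).1), op (fun i => (v i).2))) (inhabits p).

Lemma eval_modified_square X (v : X -> A * A) (t : term sg X) :
  f \notin symbols t ->
  eval (A := modified_square) v t =
  (eval (fun x => (v x).1) t, eval (fun x => (v x).2) t).
Proof.
elim: t => [x|g args IH] ft /=; first by case: (v x).
case: asboolP => [gf|_]; first by case/negP: ft; rewrite -gf; exact: mem_head.
have IH' i : eval (A := modified_square) v (args i) =
    (eval (fun x => (v x).1) (args i), eval (fun x => (v x).2) (args i)).
  by apply: IH; apply: contra ft; exact: symbols_sub.
by congr (_, _); congr op; apply: funext => i; rewrite IH'.
Qed.

(** Positive arity guarantees the first argument that the test inspects. *)
Lemma op_modified_square (u : A * A) : arity f <> 0%N ->
  op (a := modified_square) (fun _ : 'I_(arity f) => u) = if `[< u = p >] then q else p.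
Proof.
move=> f0 /=; case: asboolP => // _; congr (if _ then _ else _).
apply: asbool_equiv_eq; split=> [[i []]//|->].
have f_gt0 : (0 < arity f)%N by rewrite lt0n; apply/eqP.
by exists (Ordinal f_gt0).
Qed.

End ModifiedSquare.

(** In an infinite type some non-nullary [f] is absent from the basis and from [m]. Redefining it in
    the square of [A] stays within [V] but breaks commutation with [m]. *)
Lemma finite_type_of_finitely_based (sg : signature) (V : algebra sg -> Prop)
    (m : term sg 'I_3) : maltsev_term V m -> abelian V -> nontrivial V ->
  finite_set [set f : sg | arity f = 0%N] -> finitely_based V -> finite_type sg.
Proof.
move=> hm hab [A [VA [a [b ab]]]] fin0 [E [finE hE]].
apply: contrapT => inf.
pose U : set {classic sg} := [set f : sg | arity f = 0%N] `|`
  (\bigcup_(e in E) [set` symbols e.1 ++ symbols e.2] `|` [set` symbols m]).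
have finU : finite_set U.
  rewrite !finite_setU; split=> //; split; last exact: finite_seq.
  by apply: bigcup_finite => // e _; exact: finite_seq.
have [f fU] : exists f : sg, ~ U f.
  apply: contrapT => h; apply: inf; apply: sub_finite_set finU => f _.
  by apply: contrapT => ?; apply: h; exists f.
have f0 : arity f <> 0%N by move=> ?; apply: fU; left.
have fm : (f : {classic sg}) \notin symbols m.
  by apply/negP => ?; apply: fU; right; right.
have fE e : E e -> ((f : {classic sg}) \notin symbols e.1) /\
    ((f : {classic sg}) \notin symbols e.2).
  move=> Ee; apply/andP; rewrite -negb_or -mem_cat; apply/negP => ?.
  by apply: fU; right; left; exists e.
(* In the square, (a,a) is the [m]-value of three points other than (a,a). In a two-element [A]
   there would be no room: exchanging the two elements is affine. *)
pose B := modified_square f (a, a) (b, b).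
have VB : V B.
  apply/hE => e Ee v; have [f1 f2] := fE e Ee.
  by rewrite !eval_modified_square //; congr pair; move/hE: VA; apply.
have BE (x y z : A * A) : m3 (A := B) m x y z = (m3 m x.1 y.1 z.1, m3 m x.2 y.2 z.2).
  by rewrite /m3 eval_modified_square // (triple_map fst) (triple_map snd).
have c (u : B) := op_modified_square (A := A) (a, a) (b, b) u f0.
have := @maltsev_op _ _ _ hm hab B VB f
  (fun=> (b, a)) (fun=> (b, b)) (fun=> (a, b)).
have [h2 h1] := hm _ VA b a; have [h3 _] := hm _ VA a a.
have -> : (fun i => m3 (A := B) m (b, a) (b, b) (a, b)) =
    (fun i : 'I_(arity f) => (a, a)).
  by apply: funext => i; rewrite BE /m3 /= h2 h1.
(* The left side is now (b,b), while on the right [f] sends all three points to (a,a), a value that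
   [m] preserves. *)
rewrite !c.
have na (u : A * A) : u <> (a, a) -> `[< u = (a, a) >] = false by move=> ?; apply/asboolP.
rewrite (asboolT (erefl (a, a))) !na; do ?by case=> *; apply: ab.
by rewrite BE /= /m3 h3 => -[/esym].
Qed.
(* The last hypothesis rules out two degenerate situations in infinite types:
   the trivial variety, and infinitely many nullary symbols. In both a finite
   basis need not mention every symbol. *)
Theorem theorem1p3 (sg : signature) (V : algebra sg -> Prop)
    (hV : is_variety V) (m : term sg 'I_3) (hm : maltsev_term V m)
    (hab : abelian V)
    (hdeg : finite_type sg \/
            (nontrivial V /\ finite_set [set f : sg | arity f = 0%N])) :
  finitely_based V <->
  [/\ finite_type sg,
      finitely_presented_ring (binary_ring hm hab)
    & finitely_presented_module (unary_module hm hab)].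
Proof.
split=> [fb|[fin fpR fpM]]; last exact: (finitely_based_of_presentations hV fin fpR fpM).
have fin : finite_type sg.
  by case: hdeg => [//|[nt fin0]]; exact: (finite_type_of_finitely_based hm).
case: (fb) => E [finE hE]; split=> //.
  exact: (finitely_presented_ring_of_basis hE).
exact: (finitely_presented_module_of_basis hE).
Qed.
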